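(* Let $0<\alpha<1$, let $f\in C^\infty(\mathbb{R})$ be convex, let $\phi_->\phi_+$ be real numbers, let $$c=\frac{f(\phi_+)-f(\phi_-)}{\phi_+-\phi_-}>0,\qquad h(\phi)=-c(\phi-\phi_-)+f(\phi)-f(\phi_-),$$ with $h'(\phi_-)>0$ and $h'(\phi_+)<0$. If $\phi_\varepsilon$ is a solution of $$-c(\phi_\varepsilon(\xi)-\phi_-)+f(\phi_\varepsilon(\xi))-f(\phi_-)=\varepsilon\,\mathcal{D}^\alpha[\phi_\varepsilon](\xi),\qquad \lim_{\xi\to-\infty}\phi_\varepsilon(\xi)=\phi_-,\quad \lim_{\xi\to\infty}\phi_\varepsilon(\xi)=\phi_+,$$ then $\phi_\varepsilon\to\phi_0$ as $\varepsilon\to0$ pointwise in $\mathbb{R}$, where $$\phi_0(\xi)=\begin{cases}\phi_- & \text{if }\xi<\xi_0,\\ \phi_+ & \text{if }\xi>\xi_0,\end{cases}$$ for some $\xi_0$. Moreover, $$|\phi_\varepsilon(\xi)-\phi_-|=O\big(\exp(\lambda_\varepsilon\xi)\big)\ \text{ when }\xi\to-\infty,\quad\text{with }\lambda_\varepsilon=\Big(\frac{h'(\phi_-)}{\varepsilon}\Big)^{\frac1\alpha}>0,$$ and $$|\phi_\varepsilon(\xi)-\phi_+|=O\Big(\frac{\varepsilon}{\xi^\alpha}\Big)\ \text{ when }\xi\to+\infty .$$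
   Context: For $0<\alpha<1$, $\mathcal{D}^\alpha[g](x)=\frac{1}{\Gamma(1-\alpha)}\int_{-\infty}^x\frac{g'(z)}{(x-z)^\alpha}\,dz$. The functions $\phi_\varepsilon$ are travelling wave profiles: $u(t,x)=\phi_\varepsilon(x-ct)$ is a solution of $\partial_tu+\partial_xf(u)=\varepsilon\,\partial_x\mathcal{D}^\alpha[u]$ connecting the far-field values $\phi_-$ and $\phi_+$.
   Formalization: Since each φ_ε may be translated freely (e.g. by 1/ε), the pointwise limit is claimed only if the points where φ_ε takes some fixed value strictly between φ_+ and φ_- converge to a finite limit as ε→0; the decay estimates are unrestricted. *)

(* Defs.v *)
From HB Require Import structures.
From mathcomp Require Import all_boot all_order all_algebra.
From mathcomp Require Import all_classical all_reals all_analysis.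

Set Implicit Arguments.
Unset Strict Implicit.
Unset Printing Implicit Defensive.

Import Order.TTheory GRing.Theory Num.Theory.
Import numFieldNormedType.Exports.

Local Open Scope classical_set_scope.
Local Open Scope ring_scope.

Definition smooth (R : realType) (f : R -> R) : Prop :=
  forall (n : nat) (x : R), derivable (derive1n n f) x 1.

Definition Gamma (R : realType) (s : R) : R :=
  \int[lebesgue_measure]_(t in `]0, +oo[) (t `^ (s - 1) * expR (- t)).

(* [Rintegral] returns a junk value on non-integrable functions, so every use
   of [frac_deriv] below is paired with [frac_deriv_defined]. *)
Definition frac_deriv_kernel (R : realType) (alpha : R) (g : R -> R) (x z : R)
  : R := derive1 g z / (x - z) `^ alpha.

Definition frac_deriv_defined (R : realType) (alpha : R) (g : R -> R) (x : R)
  : Prop :=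
  (@lebesgue_measure R).-integrable `]-oo, x[
    (EFin \o frac_deriv_kernel alpha g x).

Definition frac_deriv (R : realType) (alpha : R) (g : R -> R) (x : R) : R :=
  (Gamma (1 - alpha))^-1 *
  \int[lebesgue_measure]_(z in `]-oo, x[) frac_deriv_kernel alpha g x z.

Definition wave_h (R : realType) (f : R -> R) (c phim : R) (u : R) : R :=
  - c * (u - phim) + f u - f phim.

(* Classical (C^1) solutions; phim and phip are the limits at -oo and +oo. *)
Definition wave_profile (R : realType) (alpha : R) (f : R -> R)
    (c phim phip eps : R) (phi : R -> R) : Prop :=
  [/\ forall x, derivable phi x 1,
      continuous (derive1 phi),
      forall xi, frac_deriv_defined alpha phi xi /\
        wave_h f c phim (phi xi) = eps * frac_deriv alpha phi xi,
      phi x @[x --> -oo] --> phim &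
      phi x @[x --> +oo] --> phip].

(* The profile equation is invariant under translation, so the members of an
   arbitrary family of profiles may be shifted independently of each other, and
   such a family need not converge as eps tends to 0 (shift it by 1 / eps, or
   by sin (1 / eps)). This says that the family is not drifting: the points at
   which some intermediate value m is taken converge (to a finite limit). It
   covers in particular the normalisation phi_eps(x) = m with x fixed. *)
Definition phase_converges (R : realType) (phim phip : R) (phi : R -> R -> R)
  : Prop :=
  exists (m : R) (s : R -> R),
    [/\ phip < m < phim,
        forall eps : R, 0 < eps -> phi eps (s eps) = m &
        cvg (s eps @[eps --> 0^'+])].

(* Main.v *)
Require Import Defs.
From HB Require Import structures.
From mathcomp Require Import all_boot all_order all_algebra.
From mathcomp Require Import all_classical all_reals all_analysis.
From mathcomp Require Import measurable_realfun ring lra.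

Import Order.TTheory GRing.Theory Num.Theory.
Import numFieldNormedType.Exports.

Local Open Scope classical_set_scope.
Local Open Scope ring_scope.

Set Implicit Arguments.
Unset Strict Implicit.
Unset Printing Implicit Defensive.

(** Write [w = phim - phi], [W = phim - phip], [G = Gamma (1 - a)] and let [D] be
    the Marchaud operator [D v x = \int_0^oo a t^(-a-1) (v x - v (x - t)) dt]. An
    integration by parts turns the profile equation into [D w = g w] with
    [g u = - (G / eps) h (phim - u)]. Convexity of [h] gives
    [0 <= p u := kap u - g u <= C u^2], where [kap = (G / eps) h'(phim)] and
    [lambda^a G = kap], so that [e^(lambda x)] solves the linear equation
    [D v = kap v].

    At [-oo]: the kernel [b >= 0] with [b' = lambda b - a t^(-a-1)] turns the
    equation into the differential equation [A' = lambda A - p w] for the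
    convolution [A = b * w]. Points where [|w|] exceeds all its earlier values
    satisfy [|w| <= C |A|], because all the increments in [D w] then have one sign.
    Hence [A] and [w] decay like [e^(lambda x)], and a second application to
    [w - m e^(lambda x)] gives [w = m e^(lambda x) + O(e^(2 lambda x))] with [m > 0].

    Monotonicity: by that expansion [w (x + t) > w x] near [-oo] for each [t > 0];
    at a first point of equality [D] of the difference would be both zero and
    negative.

    Concentration: where [phi] stays in a compact part of [(phip, phim)],
    [D w >= c / eps]; touching [w] from below by a line of slope [2 W / Y] bounds
    the length [Y] of such an interval by [C eps^(1/a)].

    At [+oo]: [D w >= (c / eps) (W - w)], and a multiple of [eps (x - X)^(-a)],
    cut off at the height [W], is a barrier for [W - w]. *)

(** * Integrals over the half-line *)

(** Two obstacles shape the argument. [D] sees the whole past of a point, so that no local argument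
    applies at [-oo]; and nothing is known beforehand about the sign or the monotonicity of [w], so
    that the first estimates can only be made at records of [|w|].

    The kernel [b] comes from an exact division. On [e^(s x)] the operator [D - kap] acts as the
    factor [G (s^a - lambda^a)], which vanishes at [s = lambda]; convolution with [b] has the factor
    [G (s^a - lambda^a) / (s - lambda)]. Thus [D - kap] is [d/dx - lambda] composed with [A], and
    what remains nonlocal is the comparison of [w] with [A].

    A decay rate alone would not give monotonicity: the comparison of [w] with its translate needs a
    left half-line of strict order to start from. This order is read off the leading term, which a
    translation multiplies by [e^(lambda t) > 1]; hence the need for [m > 0] and for a remainder of
    higher order. Monotonicity then confines [phi] to [[phip, phim]] and makes the places where
    [phi] lies between two values an interval, which the concentration and barrier estimates use. *)

Section half_line.
Context {R : realType}.
Notation mu := (@lebesgue_measure R).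
Implicit Types (f g F : R -> R).

Definition hintegral f : R := \int[mu]_(t in `]0, +oo[) f t.
Definition hintegrable f : Prop := mu.-integrable `]0, +oo[ (EFin \o f).

Lemma eq_hintegrable f g : (forall t, 0 < t -> f t = g t) -> hintegrable f -> hintegrable g.
Proof.
move=> fg; apply: eq_integrable => //= t; rewrite inE/= in_itv/= andbT => t0.
by rewrite fg.
Qed.

Lemma eq_hintegral f g : (forall t, 0 < t -> f t = g t) -> hintegral f = hintegral g.
Proof.
by move=> fg; apply: eq_Rintegral => t; rewrite inE/= in_itv/= andbT => /fg.
Qed.

Lemma hintegrableD f g : hintegrable f -> hintegrable g -> hintegrable (fun t => f t + g t).
Proof.
move=> hf hg.
have : mu.-integrable `]0, +oo[ ((EFin \o f) \+ (EFin \o g))%E by exact: integrableD.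
exact: eq_integrable.
Qed.

Lemma hintegrableZ (k : R) f : hintegrable f -> hintegrable (fun t => k * f t).
Proof.
move=> hf.
have : mu.-integrable `]0, +oo[ (fun t => k%:E * (EFin \o f) t)%E by exact: integrableZl.
exact: eq_integrable.
Qed.

Lemma hintegrableB f g : hintegrable f -> hintegrable g -> hintegrable (fun t => f t - g t).
Proof.
move=> hf hg.
have : mu.-integrable `]0, +oo[ ((EFin \o f) \- (EFin \o g))%E by exact: integrableB.
exact: eq_integrable.
Qed.

Lemma hintegralD f g : hintegrable f -> hintegrable g ->
  hintegral (fun t => f t + g t) = hintegral f + hintegral g.
Proof. by move=> hf hg; exact: RintegralD. Qed.

Lemma hintegralB f g : hintegrable f -> hintegrable g ->
  hintegral (fun t => f t - g t) = hintegral f - hintegral g.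
Proof. by move=> hf hg; exact: RintegralB. Qed.

Lemma hintegralZ (k : R) f : hintegrable f -> hintegral (fun t => k * f t) = k * hintegral f.
Proof. by move=> hf; exact: RintegralZl. Qed.

Lemma hintegral_le f g : hintegrable f -> hintegrable g -> (forall t, 0 < t -> f t <= g t) ->
  hintegral f <= hintegral g.
Proof.
move=> hf hg fg; apply: le_Rintegral => // t /=.
by rewrite in_itv/= andbT => /fg.
Qed.

Definition pcont f := forall t : R, 0 < t -> {for t, continuous f}.

Lemma pcont_measurable f : pcont f -> measurable_fun (`]0, +oo[ : set R) f.
Proof.
move=> cf; apply: open_continuous_measurable_fun; first exact: interval_open.
by move=> t; rewrite inE/= in_itv/= andbT => /cf.
Qed.

Lemma hintegrable_dom f g : pcont f -> hintegrable g -> (forall t, 0 < t -> `|f t| <= g t) ->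
  hintegrable f.
Proof.
move=> cf hg fg; apply: le_integrable hg => //=.
  by apply/measurable_EFinP; exact: pcont_measurable.
move=> t; rewrite in_itv/= andbT => t0.
by rewrite lee_fin (le_trans (fg _ t0))// ler_norm.
Qed.

(** Compact exhaustion, cutting off both the singularity at [0] and the tail. Starting at [n.+2]
    keeps the interval nondegenerate for [n = 0]. *)
Definition seg (n : nat) : set R := `[n.+2%:R^-1, n.+2%:R].

Lemma seg_lt n : (n.+2%:R^-1 : R) < n.+2%:R.
Proof.
by rewrite (@lt_trans _ _ 1)// ?ltr1n// invf_lt1 ?ltr1n.
Qed.

Lemma nd_seg : nondecreasing_seq seg.
Proof.
move=> m n mn; rewrite subsetEset => t; rewrite /seg/= !in_itv/= => /andP[a b].
rewrite (le_trans _ a) ?(le_trans b) ?ler_nat//.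
by rewrite lef_pV2 ?posrE// ler_nat.
Qed.

Lemma bigcup_seg : \bigcup_n seg n = `]0, +oo[%classic.
Proof.
apply/seteqP; split => t.
  by case=> n _; rewrite /seg/= !in_itv/= andbT => /andP[+ _]; apply: lt_le_trans.
rewrite /= in_itv/= andbT => t0.
pose m := maxn (Num.truncn t) (Num.truncn t^-1); exists m => //.
rewrite /seg/= in_itv/=; apply/andP; split.
  rewrite -[leRHS]invrK lef_pV2 ?posrE ?invr_gt0//.
  apply/ltW/(lt_le_trans (truncnS_gt _)).
  by rewrite ler_nat (leq_trans _ (leqnSn _))// ltnS leq_maxr.
apply/ltW/(lt_le_trans (truncnS_gt _)).
by rewrite ler_nat (leq_trans _ (leqnSn _))// ltnS leq_maxl.
Qed.

(** Dominated convergence for the restrictions of [f], with [|f|] on the union as majorant. Monotone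
    convergence would not do, as the integrands met in integration by parts change sign. *)
Lemma exhaust (D_ : (set R)^nat) f : nondecreasing_seq D_ ->
  (forall n, measurable (D_ n)) ->
  mu.-integrable (\bigcup_n D_ n) (EFin \o f) ->
  \int[mu]_(t in D_ n) f t @[n --> \oo] --> \int[mu]_(t in \bigcup_n D_ n) f t.
Proof.
move=> ndD mD intf; set D := \bigcup_n D_ n in intf *.
have mDD : measurable D by exact: bigcup_measurable.
apply: fine_cvg; rewrite fineK; last exact: integrable_fin_num.
under eq_cvg do rewrite integral_mkcond/=.
rewrite integral_mkcond.
have sDD n : D_ n `<=` D by exact: bigcup_sup.
have intfT : mu.-integrable setT ((EFin \o f) \_ D).
  by apply: (iffLR (@integrable_mkcond _ _ R mu D (EFin \o f) _)).
apply: (@dominated_cvg _ _ _ mu setT measurableT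
   (fun n => (EFin \o f) \_ (D_ n)) _ (abse \o ((EFin \o f) \_ D))).
- move=> n; apply/(measurable_restrictT _ (mD n)).
  by apply: (measurable_funS mDD (sDD n)); exact: measurable_int intf.
- move=> t _; rewrite patchE; case: ifPn => [|tD].
    rewrite inE => -[N _ DN]; apply: cvg_near_cst; exists N => // n /= Nn.
    rewrite patchE ifT// inE; have := ndD _ _ Nn.
    by rewrite subsetEset; apply.
  apply: cvg_near_cst; near=> n.
  rewrite patchE ifF//; apply/negP => tn; move/negP: tD; apply.
  by rewrite inE; apply: (sDD n); move: tn; rewrite inE.
- by move=> t _; rewrite /= patchE; case: ifPn.
- exact: integrable_abse.
- move=> n t _; rewrite /= !patchE; case: ifPn => [|_]; last first.
    by rewrite (_ : point = 0%E)// abse0 abse_ge0.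
  by rewrite inE => /sDD tD; rewrite ifT// inE.
Unshelve. all: by end_near. Qed.

Lemma hexhaust f : hintegrable f -> \int[mu]_(t in seg n) f t @[n --> \oo] --> hintegral f.
Proof.
rewrite /hintegrable/hintegral -bigcup_seg; apply: exhaust => // n.
  exact: nd_seg.
by rewrite /seg.
Qed.

Lemma seg_gt0 n t : seg n t -> 0 < t.
Proof. by rewrite /seg/= in_itv/= => /andP[+ _]; apply: lt_le_trans. Qed.

Lemma pcont_seg f n : pcont f -> {within seg n, continuous f}.
Proof.
move=> cf; apply: continuous_in_subspaceT => t; rewrite inE => /seg_gt0; exact: cf.
Qed.

Lemma cvg_segl : (n.+2%:R^-1 : R) @[n --> \oo] --> (0 : R)^'+.
Proof.
move=> A [e /= e0 eA].
exists (Num.truncn e^-1) => // n /= en; apply: eA => //=.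
rewrite sub0r normrN ger0_norm// -[ltRHS]invrK ltf_pV2 ?posrE ?invr_gt0//.
by rewrite (lt_le_trans (truncnS_gt _))// ler_nat ltnS (leq_trans en).
Qed.

Lemma cvg_segr : (n.+2%:R : R) @[n --> \oo] --> +oo.
Proof.
apply/cvgryPge => r; exists (Num.truncn r) => // n /= rn.
by rewrite (ltW (lt_le_trans (truncnS_gt _) _))// ler_nat ltnS (leq_trans rn).
Qed.

Lemma FTC_seg f F n : pcont f -> (forall t : R, 0 < t -> is_derive t (1 : R) F (f t)) ->
  (\int[mu]_(t in seg n) (f t)%:E = (F n.+2%:R - F n.+2%:R^-1)%:E)%E.
Proof.
move=> cf dF; rewrite (@continuous_FTC2 _ f F) ?EFinB//.
- exact: seg_lt.
- exact: pcont_seg.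
- have cF : pcont F.
    move=> t t0; apply/differentiable_continuous/derivable1_diffP.
    exact: (@ex_derive _ _ _ _ _ _ _ (dF _ t0)).
  split.
  + move=> t; rewrite in_itv/= => /andP[t1 _].
    by have := dF t (lt_trans _ t1); case.
  + by apply/cvg_at_right_filter; apply: cF.
  + by apply/cvg_at_left_filter; apply: cF.
- move=> t; rewrite in_itv/= => /andP[t1 _].
  by rewrite derive1E; have [] := dF t (lt_trans _ t1).
Qed.

Lemma hFTC f F (l0 l1 : R) : hintegrable f -> pcont f ->
  (forall t : R, 0 < t -> is_derive t (1 : R) F (f t)) ->
  F t @[t --> 0^'+] --> l0 -> F t @[t --> +oo] --> l1 -> hintegral f = l1 - l0.
Proof.
move=> hf cf dF F0 F1; have := hexhaust hf.
under eq_cvg do rewrite /Rintegral (FTC_seg _ cf dF)/=.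
have h : F n.+2%:R - F n.+2%:R^-1 @[n --> \oo] --> l1 - l0.
  apply: cvgB.
    exact: (cvg_comp _ _ cvg_segr F1).
  exact: (cvg_comp _ _ cvg_segl F0).
by move=> /cvg_lim <-//; move/cvg_lim : h => <-.
Qed.

(** For [f >= 0] monotone convergence computes the integral as the limit of increments of [F], which
    is finite. Integrability is thus read off an explicit primitive. *)
Lemma hFTC_ok f F (l0 l1 : R) : (forall t, 0 < t -> 0 <= f t) -> pcont f ->
  (forall t : R, 0 < t -> is_derive t (1 : R) F (f t)) ->
  F t @[t --> 0^'+] --> l0 -> F t @[t --> +oo] --> l1 -> hintegrable f.
Proof.
move=> f0 cf dF F0 F1; apply/integrableP; split.
  by apply/measurable_EFinP; exact: pcont_measurable.
rewrite (@eq_integral _ _ _ mu _ (EFin \o f)); last first.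
  move=> t; rewrite inE/= in_itv/= andbT => t0.
  by rewrite ger0_norm// f0.
have := @ge0_nondecreasing_set_cvg_integral _ (measurableTypeR R) R seg (EFin \o f)
  mu nd_seg (fun n => measurable_itv _).
rewrite bigcup_seg => /(_ _ _)/cvg_lim <-//.
- under eq_fun do rewrite (FTC_seg _ cf dF).
  have h : (F n.+2%:R - F n.+2%:R^-1)%:E @[n --> \oo] --> (l1 - l0)%:E.
    apply: cvg_EFin; first exact: nearW.
    apply: cvgB.
      exact: (cvg_comp _ _ cvg_segr F1).
    exact: (cvg_comp _ _ cvg_segl F0).
  by move/cvg_lim : h => -> //; rewrite ltry.
- move=> n; apply/measurable_EFinP.
  apply: measurable_funS (pcont_measurable cf) => // t /seg_gt0.
  by rewrite /= in_itv/= andbT.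
- by move=> n t /seg_gt0; rewrite lee_fin; exact: f0.
Qed.

End half_line.

(** * Derivatives and continuity on the real line *)

Notation der f x d := (is_derive (x : _) 1 f d).

Section derivatives.
Context {R : realType}.
Implicit Types (f g : R -> R) (x df dg k : R).

Lemma cvg0_le {T : Type} {F : set_system T} {FF : Filter F} (f g : T -> R) :
  (\forall x \near F, `|f x| <= g x) -> g @ F --> 0 -> f @ F --> 0.
Proof.
move=> fg /cvgrPdist_le g0; apply/cvgrPdist_le => e e0.
have {}g0 := g0 e e0; near=> x.
have h1 : `|f x| <= g x by near: x.
have : `|0 - g x| <= e by near: x.
by rewrite !sub0r !normrN; apply: le_trans; apply: le_trans (ler_norm _).
Unshelve. all: by end_near. Qed.

Lemma derE f x df dg : der f x df -> df = dg -> der f x dg.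
Proof. by move=> h <-. Qed.

Lemma der_cst k x : der (fun=> k) x 0.
Proof. exact: is_derive_cst. Qed.

Lemma der_id x : der (fun t : R => t) x 1.
Proof. exact: is_derive_id. Qed.

Lemma derD f g x df dg : der f x df -> der g x dg ->
  der (fun t => f t + g t) x (df + dg).
Proof. by move=> hf hg; exact: is_deriveD. Qed.

Lemma derN f x df : der f x df -> der (fun t => - f t) x (- df).
Proof. by move=> hf; exact: is_deriveN. Qed.

Lemma derB f g x df dg : der f x df -> der g x dg ->
  der (fun t => f t - g t) x (df - dg).
Proof. by move=> hf hg; exact: is_deriveB. Qed.

Lemma derM f g x df dg : der f x df -> der g x dg ->
  der (fun t => f t * g t) x (df * g x + f x * dg).
Proof.
move=> hf hg; have h := is_deriveM hf hg; apply: derE h _.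
by rewrite /GRing.scale/= addrC mulrC.
Qed.

Lemma derZ k f x df : der f x df -> der (fun t => k * f t) x (k * df).
Proof. by move=> hf; have := derM (der_cst k x) hf; rewrite mul0r add0r. Qed.

Lemma der_comp f g x df dg : der g x dg -> der f (g x) df ->
  der (fun t => f (g t)) x (df * dg).
Proof. by move=> hg hf; exact: is_derive1_comp. Qed.

Lemma derV f x df : f x != 0 -> der f x df ->
  der (fun t => (f t)^-1) x (- df / f x ^+ 2).
Proof.
move=> f0 hf; have h := is_deriveV f0 hf; apply: derE h _.
by rewrite /GRing.scale/= mulrC mulrN mulNr.
Qed.

Lemma der_cont f x df : der f x df -> {for x, continuous f}.
Proof.
move=> h; apply/differentiable_continuous/derivable1_diffP.
exact: (@ex_derive _ _ _ _ _ _ _ h).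
Qed.

Lemma contM f g x : {for x, continuous f} -> {for x, continuous g} ->
  {for x, continuous (fun t : R => f t * g t)}.
Proof. by move=> hf hg; exact: cvgM. Qed.

Lemma contD f g x : {for x, continuous f} -> {for x, continuous g} ->
  {for x, continuous (fun t : R => f t + g t)}.
Proof. by move=> hf hg; exact: cvgD. Qed.

Lemma contB f g x : {for x, continuous f} -> {for x, continuous g} ->
  {for x, continuous (fun t : R => f t - g t)}.
Proof. by move=> hf hg; exact: cvgB. Qed.

Lemma contZ k f x : {for x, continuous f} -> {for x, continuous (fun t : R => k * f t)}.
Proof. by move=> hf; exact: cvgMl_tmp. Qed.

Lemma cont_cst k x : {for x, continuous (fun=> k : R)}.
Proof. exact: cvg_cst. Qed.

Lemma cont_id x : {for x, continuous (fun t : R => t)}.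
Proof. exact: cvg_id. Qed.

Lemma contV f x : f x != 0 -> {for x, continuous f} ->
  {for x, continuous (fun t : R => (f t)^-1)}.
Proof. by move=> f0 hf; exact: cvgV. Qed.

Lemma cont_comp f g x : {for x, continuous g} -> {for g x, continuous f} ->
  {for x, continuous (fun t : R => f (g t))}.
Proof. by move=> cg cf; apply: (@continuous_comp R R R g f x). Qed.

Lemma cont_shift f (c x : R) : {for c - x, continuous f} ->
  {for x, continuous (fun t : R => f (c - t))}.
Proof.
move=> hf.
apply: (@cont_comp f (fun t => c - t) x _ hf).
apply: contB; [exact: cont_cst|exact: cont_id].
Qed.

Lemma der_shift f (c x df : R) : der f (c - x) df -> der (fun t => f (c - t)) x (- df).
Proof.
move=> h; have := der_comp (derB (der_cst c x) (der_id x)) h.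
by rewrite sub0r mulrN1.
Qed.

Lemma der_expZ (l x : R) : der (fun t => expR (l * t)) x (l * expR (l * x)).
Proof.
have := der_comp (derZ l (der_id x)) (is_derive_expR (l * x)).
by rewrite mulr1 mulrC.
Qed.

Lemma derivable_der f x : derivable f x 1 -> der f x (derive1 f x).
Proof. by move=> h; rewrite derive1E; exact: derivableP. Qed.

Lemma der_derive1 f x df : der f x df -> derive1 f x = df.
Proof. by move=> h; rewrite derive1E; case: h. Qed.

Lemma der_MVT f (df : R -> R) (a b : R) : a < b -> (forall x, a <= x <= b -> der f x (df x)) ->
  exists2 c, a < c < b & f b - f a = df c * (b - a).
Proof.
move=> ab h; have [x hx||c] := @MVT R f df a b ab.
- by apply: h; move: hx; rewrite in_itv/= => /andP[/ltW-> /ltW->].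
- apply: continuous_in_subspaceT => x; rewrite inE/= in_itv/= => hx.
  exact: der_cont (h _ hx).
- by rewrite in_itv/= => ? ?; exists c.
Qed.

Lemma der_le f (df : R -> R) (a b : R) : a <= b -> (forall x, a <= x <= b -> der f x (df x)) ->
  (forall x, a < x < b -> 0 <= df x) -> f a <= f b.
Proof.
rewrite le_eqVlt => /predU1P[->//|ab] h d0; have [c cab E] := der_MVT ab h.
by rewrite -subr_ge0 E mulr_ge0 ?d0// subr_ge0 ltW.
Qed.

Lemma der_ge f (df : R -> R) (a b : R) : a <= b -> (forall x, a <= x <= b -> der f x (df x)) ->
  (forall x, a < x < b -> df x <= 0) -> f b <= f a.
Proof.
move=> ab h d0; rewrite -lerN2.
apply: (@der_le (fun x => - f x) (fun x => - df x)) => // x.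
  by move=> /h; exact: derN.
by move=> /d0; rewrite oppr_ge0.
Qed.


Lemma der_bound f (df : R -> R) (S u v : R) :
  (forall z, Num.min u v <= z <= Num.max u v -> der f z (df z)) ->
  (forall z, Num.min u v <= z <= Num.max u v -> `|df z| <= S) ->
  `|f u - f v| <= S * `|u - v|.
Proof.
wlog uv : u v / v <= u.
  move=> h; have /orP[|uv] := le_total v u; first exact: h.
  by move=> h1 h2; rewrite distrC [X in _ * X]distrC; apply: h => // z;
    rewrite minC maxC => zz; [exact: h1|exact: h2].
rewrite (min_idPr uv) (max_idPl uv) => h1 h2.
move: uv; rewrite le_eqVlt => /predU1P[->|vu]; first by rewrite !subrr !normr0 mulr0.
have [c /andP[c1 c2] ->] := der_MVT vu h1.
by rewrite normrM ler_wpM2r// h2// !ltW.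
Qed.

(** Sequential form of differentiability: the dominated convergence used to differentiate a
    convolution is about sequences. *)
Lemma der_lim f x df : (forall u : nat -> R, (forall n, u n != 0) ->
    u n @[n --> \oo] --> 0 -> (f (x + u n) - f x) / u n @[n --> \oo] --> df) ->
  der f x df.
Proof.
move=> h.
have H : h^-1 *: (f (h *: 1 + x) - f x) @[h --> 0^'] --> df.
  apply/cvgr_dnbhsP => u [un u0].
  have := h u un u0; apply: cvg_trans; apply: near_eq_cvg; apply: nearW => n.
  by rewrite /GRing.scale/= mulr1 mulrC [u n + x]addrC.
apply: DeriveDef; first by apply/cvg_ex; exists df.
exact: cvg_lim H.
Qed.

Lemma der_seq f x df (u : nat -> R) : der f x df -> (forall n, u n != 0) ->
  u n @[n --> \oo] --> 0 -> (f (x + u n) - f x) / u n @[n --> \oo] --> df.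
Proof.
move=> [dfx <-] un u0.
have /cvgr_dnbhsP/(_ u (conj un u0)) : h^-1 *: (f (h *: 1 + x) - f x) @[h --> 0^'] -->
    'D_1 f x by [].
apply: cvg_trans; apply: near_eq_cvg; apply: nearW => n.
by rewrite /GRing.scale/= mulr1 mulrC [u n + x]addrC.
Qed.

Lemma nincr_cvg0_ge0 f (df : R -> R) : (forall x, 0 < x -> der f x (df x)) ->
  (forall x, 0 < x -> df x <= 0) -> f x @[x --> +oo] --> 0 ->
  forall x, 0 < x -> 0 <= f x.
Proof.
move=> h d0 f0 x x0; have hc : f y @[y --> +oo] --> 0 by [].
apply: (cvgr_to_le hc); near=> y.
apply: (@der_ge f df) => [|z /andP[xz _]|z /andP[xz _]].
- by near: y; apply: nbhs_pinfty_ge; rewrite num_real.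
- by apply: h; rewrite (lt_le_trans x0).
- by apply: d0; rewrite (lt_trans x0).
Unshelve. all: by end_near. Qed.

End derivatives.
Arguments contM {R f g x} _ _.
Arguments contD {R f g x} _ _.
Arguments contB {R f g x} _ _.
Arguments contZ {R} k {f x} _.
Arguments cont_cst {R} k x.
Arguments cont_id {R} x.
Arguments contV {R f x} _ _.
Arguments cont_comp {R} f g x _ _.
Arguments cont_shift {R} f c x _.

Section primitive.
Context {R : realType}.
Notation mu := (@lebesgue_measure R).
Implicit Types (f g F : R -> R).

Lemma primitive f : pcont f -> hintegrable f -> (forall t : R, 0 < t -> 0 <= f t) ->
  exists P : R -> R, [/\ forall t : R, 0 < t -> der P t (f t),
    P t @[t --> 0^'+] --> 0 & P t @[t --> +oo] --> hintegral f].
Proof.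
move=> cf hf f0; pose P x := \int[mu]_(t in `]0, x]) f t.
have sub0 x y : x <= y -> (`]0, x]%classic : set R) `<=` `]0, y].
  by move=> xy; apply: subset_itvl; rewrite bnd_simp.
have suby x : (`]0, x]%classic : set R) `<=` `]0, +oo[.
  by apply: subset_itvl; rewrite bnd_simp.
have ok x : mu.-integrable `]0, x] (EFin \o f).
  by apply: integrableS hf => //; exact: suby.
have pos x : (`]0, x]%classic : set R) `<=` [set t | 0 <= f t].
  by move=> t /=; rewrite in_itv/= => /andP[/f0].
have dP (t : R) : 0 < t -> der P t (f t).
  move=> t0; have [] := @continuous_FTC1 R f (BRight 0) t (t + 1) _ (ok _) _ _.
  - by rewrite ltrDl.
  - by rewrite (@lte_fin R).
  - exact: cf.
  by move=> /derivable_der h E; exact: derE h E.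
have Pnd : nondecreasing_fun P.
  move=> x y xy; rewrite -lee_fin !fineK ?integrable_fin_num//.
  apply: ge0_subset_integral => //=.
  - by case/integrableP : (ok y).
  - by move=> t /pos; rewrite lee_fin.
  - exact: sub0.
have PM x : P x <= hintegral f.
  rewrite -lee_fin !fineK ?integrable_fin_num//.
  apply: ge0_subset_integral => //=.
  - by case/integrableP : hf.
  - by move=> t; rewrite in_itv/= andbT lee_fin; exact: f0.
have P0 x : 0 <= P x by apply: Rintegral_ge0 => t /pos.
have [l1 Pl1] : exists l1 : R, P r @[r --> +oo] --> l1.
  eexists; apply: nondecreasing_cvgr => //.
  by exists (hintegral f) => _ [x _ <-].
(* The limit [l0] is not computed: subtracting it normalises [P], and [hFTC] identifies [l1 - l0]
   with the whole integral. *)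
have [l0 Pl0] : exists l0 : R, P r @[r --> 0^'+] --> l0.
  eexists; apply: (@nondecreasing_at_right_cvgr _ P 0 +oo%O) => //.
    by move=> x y _ _; exact: Pnd.
  by exists 0 => _ [x _ <-].
have E := hFTC hf cf dP Pl0 Pl1.
exists (fun t => P t - l0); split.
- by move=> t t0; have := derB (dP t t0) (der_cst l0 t); rewrite subr0.
- by rewrite -[X in _ --> X](subrr l0); apply: cvgB => //; exact: cvg_cst.
- by rewrite E; apply: cvgB => //; exact: cvg_cst.
Qed.

End primitive.

(** * The kernels *)

Section power.
Context {R : realType}.
Variable a : R.
Hypotheses (a0 : 0 < a) (a1 : a < 1).

Definition pk (t : R) : R := t `^ (- a).

Lemma pk_gt0 (t : R) : 0 < t -> 0 < pk t.
Proof. exact: powR_gt0. Qed.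

Lemma der_pk (t : R) : 0 < t -> der pk t (- (a * (pk t / t))).
Proof.
move=> t0; apply: derE (is_derive1_powR _ t0) _.
rewrite powRB ?powRr1 ?(ltW t0)//; first by rewrite mulNr.
by rewrite (gt_eqF t0) implybT.
Qed.

Lemma pkM (s t : R) : 0 <= s -> 0 <= t -> pk (s * t) = pk s * pk t.
Proof. exact: powRM. Qed.

Lemma pk_cvgy : pk t @[t --> +oo] --> 0.
Proof.
have h : (t `^ a)^-1 @[t --> +oo] --> (0 : R).
  apply/cvgrPdist_le => e e0; near=> t.
  have t0 : 0 < t by near: t; exact: nbhs_pinfty_gt.
  have te : e^-1 `^ a^-1 <= t by near: t; apply: nbhs_pinfty_ge; rewrite num_real.
  rewrite sub0r normrN ger0_norm ?invr_ge0 ?powR_ge0//.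
  rewrite -[leRHS]invrK lef_pV2 ?posrE ?invr_gt0 ?powR_gt0//.
  rewrite -[leLHS]powRr1 ?invr_ge0 ?(ltW e0)//.
  rewrite -[X in _ `^ X](mulVf (lt0r_neq0 a0)) powRrM.
  by apply: ge0_ler_powR; rewrite ?nnegrE ?powR_ge0 ?(ltW a0) ?(ltW t0).
by apply: cvg_trans h; apply: near_eq_cvg; near=> t; rewrite /pk powRN.
Unshelve. all: by end_near. Qed.

Lemma tpkE (t : R) : 0 < t -> t * pk t = t `^ (1 - a).
Proof.
move=> t0; rewrite powRD ?powRr1 ?(ltW t0)//.
by rewrite (gt_eqF t0) implybT.
Qed.

Lemma tpk_cvg0 : t * pk t @[t --> 0^'+] --> 0.
Proof.
have h : t `^ (1 - a) @[t --> 0^'+] --> (0 : R) by apply: powR_cvg0; rewrite subr_gt0.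
apply: cvg_trans h; apply: near_eq_cvg; near=> t; rewrite tpkE//.
Unshelve. all: by end_near. Qed.

Lemma pk_le_pow (x : R) : 0 < x -> x <= 1 -> pk x * x <= 1.
Proof.
move=> x0 x1; rewrite mulrC tpkE//.
by rewrite -[leRHS](powRr0 x); apply: ger_powR; rewrite ?x0 ?x1// subr_ge0 ltW.
Qed.

(* The comparison function is [t^(1-a)/((1-a)(t+r)) - C (t+r)^(-a)], whose
   derivative dominates [t^(-a)/(t+r)]. *)
Definition domC : R := (1 - a)^-1 + a^-1.

Lemma hintegrable_hintegral_dom (r : R) : 0 < r -> hintegrable (fun t => pk t / (t + r)) /\
  hintegral (fun t => pk t / (t + r)) <= domC * pk r.
Proof.
move=> r0.
have c0 : 0 < (1 - a)^-1 by rewrite invr_gt0 subr_gt0.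
pose F t := (1 - a)^-1 * (t * pk t * (t + r)^-1) - domC * pk (t + r).
pose f t := (1 - a)^-1 * ((1 - a) * pk t / (t + r) - t * pk t * ((t + r)^-1 * (t + r)^-1))
   + domC * (a * (pk (t + r) / (t + r))).
have tr (t : R) : 0 < t -> 0 < t + r by move=> ?; rewrite addr_gt0.
have dtr (t : R) : der (fun t : R => t + r) t 1.
  by apply: derE (derD (der_id t) (der_cst r t)) _; rewrite addr0.
have dtrV (t : R) : 0 < t -> der (fun t : R => (t + r)^-1) t (- 1 / (t + r) ^+ 2).
  by move=> t0; apply: derV => //; rewrite gt_eqF// tr.
have dpkr (t : R) : 0 < t -> der (fun t => pk (t + r)) t (- (a * (pk (t + r) / (t + r)))).
  move=> t0; have := der_comp (dtr t) (der_pk (tr _ t0)).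
  by rewrite mulr1.
have dF (t : R) : 0 < t -> der F t (f t).
  move=> t0.
  refine (derE (derB (derZ _ (derM (derM (der_id t) (der_pk t0)) (dtrV t t0)))
    (derZ _ (dpkr t t0))) _).
  have trn : t + r != 0 by rewrite gt_eqF// tr.
  have tn : t != 0 by rewrite gt_eqF.
  have an : 1 - a != 0 by rewrite subr_eq0 gt_eqF.
  rewrite /f; field; by rewrite trn tn an.
have cpk (t : R) : 0 < t -> {for t, continuous pk}.
  by move=> t0; exact: der_cont (der_pk t0).
have ctrV (t : R) : 0 < t -> {for t, continuous (fun t : R => (t + r)^-1)}.
  by move=> t0; exact: der_cont (dtrV _ t0).
have cpkr (t : R) : 0 < t -> {for t, continuous (fun t => pk (t + r))}.
  by move=> t0; exact: der_cont (dpkr _ t0).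
(* [f] is [pk t / (t + r)] minus [(1 - a)^-1 * t * pk t / (t + r) ^+ 2], plus a compensating term.
   The latter suffices because [domC * a = (1 - a)^-1] and [x^(1 - a) <= 1] at [x = t / (t + r)]. *)
have f_ge (t : R) : 0 < t -> pk t / (t + r) <= f t.
  move=> t0.
  have h : pk t * (t / (t + r)) <= pk (t + r).
    have x0 : 0 < t / (t + r) by rewrite divr_gt0// tr.
    have x1 : t / (t + r) <= 1 by rewrite ler_pdivrMr ?tr// mul1r lerDl ltW.
    have E : pk t = pk (t + r) * pk (t / (t + r)).
      rewrite -pkM ?(ltW x0) ?(ltW (tr _ t0))//.
      by rewrite mulrCA divff ?mulr1// gt_eqF// tr.
    rewrite E -mulrA -[leRHS]mulr1 ler_pM2l ?pk_gt0 ?tr//.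
    exact: pk_le_pow.
  have trn : t + r != 0 by rewrite gt_eqF// tr.
  have an : 1 - a != 0 by rewrite subr_eq0 gt_eqF.
  have an0 : a != 0 by rewrite gt_eqF.
  have E : pk t / (t + r) = (1 - a)^-1 * ((1 - a) * pk t / (t + r) - t * pk t / (t + r) ^+ 2)
    + domC * (a * (pk t * (t / (t + r)) / (t + r))).
    rewrite /domC; field; by rewrite an0 trn an.
  rewrite E /f expr2 invfM lerD2l ler_wpM2l//.
    by rewrite /domC addr_ge0// ltW// invr_gt0.
  by rewrite ler_wpM2l ?(ltW a0)// ler_pM2r ?invr_gt0 ?tr.
have f0 (t : R) : 0 < t -> 0 <= f t.
  move=> t0; apply: le_trans (f_ge _ t0).
  by rewrite divr_ge0 ?ltW ?pk_gt0 ?tr.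
have F0 : F t @[t --> 0^'+] --> - (domC * pk r).
  rewrite -[X in _ --> X]add0r; apply: cvgB.
    rewrite -[X in _ --> X](mulr0 (1 - a)^-1); apply: cvgMl_tmp.
    rewrite -[X in _ --> X](mul0r (0 + r)^-1); apply: cvgM; first exact: tpk_cvg0.
    apply: cvg_at_right_filter; apply: cvgV; first by rewrite add0r gt_eqF.
    by apply: cvgD; [exact: cvg_id|exact: cvg_cst].
  apply: cvgMl_tmp; rewrite -[X in _ --> pk X](add0r r).
  have cc : {for 0 + r, continuous pk} by apply: cpk; rewrite add0r.
  have crr : t + r @[t --> 0^'+] --> 0 + r.
    by apply: cvg_at_right_filter; apply: cvgD; [exact: cvg_id|exact: cvg_cst].
  exact: (cvg_comp _ _ crr cc).
have F1 : F t @[t --> +oo] --> 0.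
  rewrite -[X in _ --> X]subr0; apply: cvgB.
    rewrite -[X in _ --> X](mulr0 (1 - a)^-1); apply: cvgMl_tmp.
    apply: (cvg0_le _ pk_cvgy).
    near=> t; have t0 : 0 < t by near: t; exact: nbhs_pinfty_gt.
    rewrite ger0_norm ?divr_ge0 ?mulr_ge0 ?(ltW t0) ?(ltW (pk_gt0 _)) ?(ltW (tr _ _))//.
    by rewrite ltW// ltr_pdivrMr ?tr// mulrC ltr_pM2l ?pk_gt0// ltrDl.
  rewrite -[X in _ --> X](mulr0 domC); apply: cvgMl_tmp.
  apply: (cvg_comp _ _ _ pk_cvgy).
  exact: cvg_addrr.
have cf : pcont f.
  move=> t t0; have c1 := cpk t t0; have c2 := ctrV t t0.
  refine (contD (contZ _ (contB (contM (contZ _ c1) c2) _)) (contZ _ (contZ _ _))).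
    exact: (contM (contM (cont_id t) c1) (contM c2 c2)).
  exact: contM (cpkr t t0) c2.
have hf := hFTC_ok f0 cf dF F0 F1.
have ok : hintegrable (fun t => pk t / (t + r)).
  apply: (hintegrable_dom _ hf).
    by move=> t t0; apply: cvgM; [exact: cpk|exact: ctrV].
  move=> t t0; rewrite ger0_norm ?f_ge//.
  by rewrite divr_ge0 ?ltW ?pk_gt0 ?tr.
split => //; apply: (le_trans (hintegral_le ok hf f_ge)).
by rewrite (hFTC hf cf dF F0 F1) sub0r opprK.
Unshelve. all: by end_near. Qed.

End power.

Section kernel.
Context {R : realType}.

Lemma hintegral_gt0 (f : R -> R) : pcont f -> hintegrable f ->
  (forall t : R, 0 < t -> 0 < f t) -> 0 < hintegral f.
Proof.
move=> cf hf f0.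
have f0' (t : R) : 0 < t -> 0 <= f t by move=> /f0/ltW.
have [P [dP P0 Py]] := primitive cf hf f0'.
have Pnd (x y : R) : 0 < x -> x <= y -> P x <= P y.
  move=> x0 xy; apply: (der_le xy) => z /andP[xz _].
    by apply: dP; exact: lt_le_trans xz.
  by apply: f0'; exact: lt_trans xz.
have P1 : 0 <= P 1.
  apply: (cvgr_to_le P0); near=> t; apply: Pnd => //.
  by near: t; apply: nbhs_right_le.
have P12 : P 1 < P 2.
  have [|x /andP[x1 _]|c /andP[c1 _] E] := @der_MVT _ P f 1 2; first lra.
    by apply: dP; exact: lt_le_trans x1.
  by rewrite -subr_gt0 E mulr_gt0// ?f0 ?(lt_trans _ c1)//; lra.
apply: (lt_le_trans (le_lt_trans P1 P12)).
apply: (cvgr_to_ge Py); near=> t.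
have t2 : 2 <= t by near: t; apply: nbhs_pinfty_ge; rewrite num_real.
exact: Pnd.
Unshelve. all: by end_near. Qed.

Lemma pcont_pk (a : R) : pcont (pk a).
Proof. by move=> t t0; exact: der_cont (der_pk a t0). Qed.

Definition ek (a l t : R) : R := expR (- l * t) * pk a t.

Lemma ek_gt0 (a l t : R) : 0 < t -> 0 < ek a l t.
Proof. by move=> t0; rewrite mulr_gt0 ?expR_gt0 ?pk_gt0. Qed.

Lemma pcont_ek (a l : R) : pcont (ek a l).
Proof.
by move=> t t0; apply: contM (pcont_pk t0); exact: der_cont (der_expZ _ _).
Qed.

Lemma hintegrable_ek (a l : R) : 0 < a -> a < 1 -> 0 < l -> hintegrable (ek a l).
Proof.
move=> a0 a1 l0; have [hd _] := hintegrable_hintegral_dom a0 a1 ltr01.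
apply: (hintegrable_dom (@pcont_ek a l) (hintegrableZ (1 + l^-1) hd)) => t t0.
rewrite ger0_norm ?(ltW (ek_gt0 _ _ _))//.
rewrite /ek mulrC [leRHS]mulrCA ler_pM2l ?pk_gt0//.
rewrite ler_pdivlMr ?addr_gt0// mulNr expRN.
have lt0 : 0 < 1 + l * t by rewrite addr_gt0// mulr_gt0.
rewrite mulrC ler_pdivrMr ?expR_gt0//.
apply: (@le_trans _ _ ((1 + l^-1) * (1 + l * t))); last first.
  by rewrite ler_pM2l ?expR_ge1Dx// addr_gt0// invr_gt0.
rewrite (_ : (1 + l^-1) * (1 + l * t) = t + 1 + (l * t + l^-1)).
  by rewrite lerDl addr_ge0 ?mulr_ge0 ?invr_ge0 ?ltW.
by field; rewrite gt_eqF.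
Qed.

Lemma Gamma_ek (a : R) : Gamma (1 - a) = hintegral (ek a 1).
Proof.
apply: eq_hintegral => t t0; rewrite /ek /pk mulrC mulN1r.
by congr (_ * _ `^ _); ring.
Qed.

Lemma Gamma1a_gt0 (a : R) : 0 < a -> a < 1 -> 0 < Gamma (1 - a).
Proof.
move=> a0 a1; rewrite Gamma_ek; apply: hintegral_gt0.
- exact: pcont_ek.
- exact: hintegrable_ek.
- by move=> t; exact: ek_gt0.
Qed.

Lemma hintegral_ek (a l : R) : 0 < a -> a < 1 -> 0 < l ->
  l * hintegral (ek a l) = l `^ a * Gamma (1 - a).
Proof.
move=> a0 a1 l0; rewrite Gamma_ek.
have [P [dP P0 Py]] := primitive (@pcont_ek a 1) (hintegrable_ek a0 a1 ltr01)
  (fun t t0 => ltW (ek_gt0 a 1 t0)).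
(* The substitution [s = l * t], carried out on a primitive; [pk a (l * t) = l^(- a) * pk a t] fixes
   the prefactor. *)
have dF (t : R) : 0 < t -> der (fun t => l `^ a / l * P (l * t)) t (ek a l t).
  move=> t0; have lt0 : 0 < l * t by rewrite mulr_gt0.
  refine (derE (derZ _ (der_comp (derZ l (der_id t)) (dP _ lt0))) _).
  rewrite /ek pkM ?ltW// mulr1 mulN1r mulNr.
  have -> : pk a l = (l `^ a)^-1 by rewrite /pk powRN.
  have h1 : l != 0 by rewrite gt_eqF.
  have h2 : l `^ a != 0 by rewrite gt_eqF// powR_gt0.
  by field; rewrite h1 h2.
have cl0 : l * t @[t --> 0^'+] --> 0^'+.
  move=> A [e /= e0 eA]; exists (e / l) => /=; first by rewrite divr_gt0.
  move=> t /=; rewrite sub0r normrN => te t0; apply: eA; last by rewrite mulr_gt0.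
  by rewrite /= sub0r normrN normrM (gtr0_norm l0) mulrC -ltr_pdivlMr.
have cly : l * t @[t --> +oo] --> +oo.
  by apply: gt0_cvgMry => //; exact: cvg_id.
have := hFTC (hintegrable_ek a0 a1 l0) (@pcont_ek a l) dF
  (cvgMl_tmp (cvg_comp _ _ cl0 P0)) (cvgMl_tmp (cvg_comp _ _ cly Py)).
by move=> ->; rewrite mulr0 subr0 mulrA mulrCA divff ?mulr1// gt_eqF.
Qed.

Definition nuk (a t : R) : R := a * (pk a t / t).

Lemma pcont_nuk (a : R) : pcont (nuk a).
Proof.
move=> t t0; apply: contZ; apply: contM; first exact: pcont_pk.
by apply: contV; [rewrite gt_eqF|exact: cont_id].
Qed.

Lemma nuk_gt0 (a t : R) : 0 < a -> 0 < t -> 0 < nuk a t.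
Proof. by move=> a0 t0; rewrite mulr_gt0// divr_gt0// pk_gt0. Qed.

(** The bound in the fourth clause joins the singularity [t^(-a)] at [0] to the decay [t^(-a-1)] at
    infinity. The last clause makes [l * hintegral b] the factor by which the Marchaud operator
    multiplies [e^(l x)]. *)
Definition laplace_kernel (a l : R) (b : R -> R) : Prop :=
  [/\ [/\ 0 < a, a < 1 & 0 < l],
    forall t : R, 0 < t -> der b t (l * b t - nuk a t),
    forall t, 0 < t -> 0 <= b t,
    forall t, 0 < t -> b t <= a * (pk a t / (l * t + a)) &
    hintegrable b /\ hintegral b = hintegral (ek a l)].

(* [b t = k t - l * e^(l t) * \int_t^oo e^(-l s) k s ds], i.e. the Laplace
   transform in [s] of [nuk (t + s)]. *)
Lemma laplace_kernel_exists (a l : R) : 0 < a -> a < 1 -> 0 < l ->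
  exists b : R -> R, laplace_kernel a l b.
Proof.
move=> a0 a1 l0; have hk := hintegrable_ek a0 a1 l0.
have [P [dP P0 Py]] := primitive (@pcont_ek a l) hk
  (fun t t0 => ltW (ek_gt0 a l t0)).
pose M t := hintegral (ek a l) - P t.
have dM (t : R) : 0 < t -> der M t (- ek a l t).
  by move=> t0; refine (derE (derB (der_cst _ t) (dP t t0)) (sub0r _)).
have M0 : M t @[t --> 0^'+] --> hintegral (ek a l).
  by rewrite -[X in _ --> X]subr0; apply: cvgB P0; exact: cvg_cst.
have My : M t @[t --> +oo] --> 0.
  by rewrite -[X in _ --> X](subrr (hintegral (ek a l))); apply: cvgB Py; exact: cvg_cst.
have dek (t : R) : 0 < t -> der (ek a l) t (- (l + a / t) * ek a l t).
  move=> t0; refine (derE (derM (der_expZ _ _) (der_pk a t0)) _).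
  by rewrite /ek; field; rewrite gt_eqF.
have eky : ek a l t @[t --> +oo] --> 0.
  apply: (cvg0_le _ (pk_cvgy a0)); near=> t.
  have t0 : 0 < t by near: t; exact: nbhs_pinfty_gt.
  rewrite ger0_norm ?(ltW (ek_gt0 _ _ _))// ltW// /ek mulrC gtr_pMr ?pk_gt0// expR_lt1.
  by rewrite mulNr oppr_lt0 mulr_gt0.
(* The tail [M] is bounded on both sides by one device: a function that decreases to [0] is
   nonnegative. The upper bound will give [0 <= b], and the lower bound [M2] the upper bound on
   [b]. *)
have M1 (t : R) : 0 < t -> l * M t <= ek a l t.
  move=> t0; rewrite -subr_ge0.
  apply: (@nincr_cvg0_ge0 _ (fun t => ek a l t - l * M t)
    (fun t => - (l + a / t) * ek a l t - l * - ek a l t)) t0.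
  - by move=> x x0; exact: derB (dek _ x0) (derZ _ (dM _ x0)).
  - move=> x x0; rewrite (_ : _ - _ = - (a / x * ek a l x)); last by ring.
    by rewrite oppr_le0 mulr_ge0 ?divr_ge0 ?ltW ?ek_gt0.
  - rewrite -[X in _ --> X](subr0 0); apply: cvgB => //.
    by rewrite -[X in _ --> X](mulr0 l); exact: cvgMl_tmp.
have la (t : R) : 0 < t -> 0 < l * t + a by move=> t0; rewrite addr_gt0// mulr_gt0.
have dla (t : R) : 0 < t -> der (fun t => t * (l * t + a)^-1) t (a / (l * t + a) ^+ 2).
  move=> t0; have lan : l * t + a != 0 by rewrite gt_eqF// la.
  refine (derE (derM (der_id t) (@derV _ (fun t => l * t + a) _ _ lan
    (derD (derZ l (der_id t)) (der_cst a t)))) _).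
  by field.
have M2 (t : R) : 0 < t -> ek a l t * (t / (l * t + a)) <= M t.
  move=> t0; rewrite -subr_ge0.
  apply: (@nincr_cvg0_ge0 _ (fun t => M t - ek a l t * (t / (l * t + a)))
    (fun t => - (a / (l * t + a) ^+ 2) * ek a l t)) t0.
  - move=> x x0.
    refine (derE (derB (dM _ x0) (derM (dek _ x0) (dla _ x0))) _).
    by field; rewrite !gt_eqF ?la.
  - move=> x x0; rewrite mulNr oppr_le0 mulr_ge0 ?divr_ge0 ?ltW ?ek_gt0//.
    by rewrite exprn_gt0// la.
  - rewrite -[X in _ --> X](subr0 0); apply: cvgB => //.
    apply: (@cvg0_le _ _ _ _ _ (fun t => l^-1 * ek a l t)).
      near=> x; have x0 : 0 < x by near: x; exact: nbhs_pinfty_gt.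
      have xla : 0 <= x / (l * x + a) by rewrite divr_ge0 ?ltW ?la.
      rewrite ger0_norm; last exact: mulr_ge0 (ltW (ek_gt0 _ _ x0)) xla.
      rewrite mulrC ler_pM2r ?ek_gt0// ler_pdivrMr ?la// mulrDr mulKf ?gt_eqF//.
      by rewrite lerDl mulr_ge0 ?invr_ge0 ?ltW.
    by rewrite -[X in _ --> X](mulr0 l^-1); exact: cvgMl_tmp.
have ee (t : R) : expR (l * t) * expR (- l * t) = 1.
  by rewrite -expRD mulNr subrr expR0.
pose B t := expR (l * t) * M t.
have dB (t : R) : 0 < t -> der B t (l * B t - pk a t).
  move=> t0; refine (derE (derM (der_expZ _ _) (dM _ t0)) _).
  by rewrite /B /ek mulrN mulrA mulrA ee mul1r.
pose b t := pk a t - l * B t.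
have db (t : R) : 0 < t -> der b t (l * b t - nuk a t).
  move=> t0; refine (derE (derB (der_pk a t0) (derZ l (dB _ t0))) _).
  by rewrite /b /nuk; ring.
have b0 (t : R) : 0 < t -> 0 <= b t.
  move=> t0; rewrite subr_ge0 /B mulrCA.
  rewrite -[leRHS]mul1r -(ee t) -mulrA ler_pM2l ?expR_gt0//.
  exact: M1.
have b1 (t : R) : 0 < t -> b t <= a * (pk a t / (l * t + a)).
  move=> t0; have lan : l * t + a != 0 by rewrite gt_eqF// la.
  rewrite (_ : a * _ = pk a t - l * (pk a t * (t / (l * t + a)))); last by field.
  rewrite lerD2l lerN2 ler_pM2l// -[leLHS]mul1r -(ee t) -!mulrA ler_pM2l ?expR_gt0//.
  by rewrite mulrA; exact: M2.
have hb : hintegrable b.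
  have [hd _] := hintegrable_hintegral_dom a0 a1 ltr01.
  apply: (hintegrable_dom _ (hintegrableZ (1 + a / l) hd)) => t t0.
    exact: der_cont (db _ t0).
  rewrite ger0_norm ?b0// (le_trans (b1 _ t0))// mulrCA [leRHS]mulrCA.
  rewrite ler_pM2l ?pk_gt0// ler_pdivrMr ?la// mulrAC ler_pdivlMr ?addr_gt0//.
  rewrite (_ : (1 + a / l) * (l * t + a) = a * (t + 1) + (l * t + a * a / l)).
    by rewrite lerDl addr_ge0 ?divr_ge0 ?mulr_ge0 ?ltW.
  by field; rewrite gt_eqF.
exists b; split => //; split => //.
have dBN (t : R) : 0 < t -> der (fun t => - B t) t (b t).
  by move=> t0; refine (derE (derN (dB _ t0)) _); rewrite /b opprB.
rewrite -[RHS](@opprK _ (hintegral (ek a l))) -[RHS]sub0r.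
apply: (@hFTC _ b (fun t => - B t)) => //.
- by move=> t t0; exact: der_cont (db _ t0).
- apply: cvgN; rewrite (_ : hintegral (ek a l) = expR (l * 0) * hintegral (ek a l)).
    apply: cvgM M0; apply: cvg_at_right_filter.
    exact: der_cont (der_expZ l 0).
  by rewrite mulr0 expR0 mul1r.
- rewrite -[X in _ --> X]oppr0; apply: cvgN.
  apply: (@cvg0_le _ _ _ _ _ (fun t => l^-1 * pk a t)).
    near=> x; have x0 : 0 < x by near: x; exact: nbhs_pinfty_gt.
    have M0' : 0 <= M x.
      apply: le_trans (M2 _ x0).
      by rewrite mulr_ge0 ?divr_ge0 ?ltW ?ek_gt0 ?la.
    rewrite ger0_norm ?mulr_ge0 ?expR_ge0//.
    by rewrite ler_pdivlMl// -subr_ge0; exact: b0.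
  by rewrite -[X in _ --> X](mulr0 l^-1); apply: cvgMl_tmp; exact: pk_cvgy.
Unshelve. all: by end_near. Qed.

End kernel.

(** * The reflection [z -> x - z] *)

Section reflection.
Context {R : realType}.
Notation mu := (@lebesgue_measure R).

Definition reflect (x : R) (z : measurableTypeR R) : measurableTypeR R := x - z.

Lemma measurable_reflect (x : R) : measurable_fun setT (reflect x).
Proof. exact: measurable_funB. Qed.

HB.instance Definition _ (x : R) :=
  isMeasurableFun.Build _ _ _ _ (reflect x) (measurable_reflect x).

(** Lebesgue measure is determined by its values on half-open intervals. The reflection exchanges
    the open and the closed end, which does not affect the length. *)
Lemma lebesgue_measure_reflect (x : R) (A : set R) : measurable A ->
  pushforward mu (reflect x) A = mu A.
Proof.
move=> mA; apply/esym.
apply: (@lebesgue_measure_unique R (pushforward mu (reflect x))).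
move=> _ [[u v]] _ <-.
rewrite /pushforward.
rewrite [X in _ = mu X](_ : _ = `[x - v, x - u[%classic); last first.
  by apply/seteqP; split => z /=; rewrite /reflect/= !in_itv/= => /andP[h1 h2];
    apply/andP; split; lra.
rewrite !lebesgue_measure_itv/= !lte_fin ltrD2l ltrN2.
by case: ifPn => // _; rewrite -!EFinD; congr EFin; ring.
exact: mA.
Qed.
Lemma hintegrable_hintegral_reflect (x : R) (F G : R -> R) : measurable_fun setT F ->
  (forall z, z < x -> F (x - z) = G z) ->
  mu.-integrable `]-oo, x[ (EFin \o G) ->
  hintegrable F /\ hintegral F = \int[mu]_(z in `]-oo, x[) G z.
Proof.
move=> mF FG intG.
pose ph := reflect x.
have preE : ph @^-1` `]0, +oo[ = `]-oo, x[%classic.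
  by apply/seteqP; split => z /=; rewrite /ph/reflect !in_itv/= andbT subr_gt0.
have mFE : measurable_fun setT (EFin \o F : measurableTypeR R -> \bar R).
  exact/measurable_EFinP.
have intF : mu.-integrable (ph @^-1` `]0, +oo[) ((EFin \o F) \o ph).
  rewrite preE; apply: eq_integrable intG => //.
  by move=> z; rewrite inE/= in_itv/= => zx; rewrite /ph/reflect/= FG.
have mph : measurable_fun setT ph by exact: measurable_reflect.
have E := integral_pushforward mph mFE intF (measurable_itv _).
have I := integrable_pushforward mph mFE intF (measurable_itv _).
have Emu (g : measurableTypeR R -> \bar R) :
    (\int[pushforward mu ph]_(y in `]0%R, +oo[) g y = \int[mu]_(y in `]0%R, +oo[) g y)%E.
  apply: eq_measure_integral => A mA _.
  exact: lebesgue_measure_reflect.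
split.
  apply/integrableP; split; first exact: measurable_funTS.
  by case/integrableP : I => _; rewrite Emu.
rewrite /hintegral /Rintegral -Emu E preE; congr fine; apply: eq_integral => z.
by rewrite inE/= in_itv/= => zx; rewrite /ph/reflect/= FG.
Qed.

End reflection.

(** * The Marchaud operator *)

Section marchaud.
Context {R : realType}.
Variable a : R.
Hypotheses (a0 : 0 < a) (a1 : a < 1).

(** Kernels, possibly of changing sign, that are no more singular than [nuk a]: besides [nuk a]
    itself, the kernel [b] and the difference [nuk a - l * b]. *)
Definition adm (q : R -> R) := pcont q /\
  exists C : R, forall t, 0 < t -> `|q t| <= C * (pk a t / t).

(* [t / (t + 1)] is comparable to [min 1 t]. *)
Definition tame (v : R -> R) (x : R) :=
  exists L : R, forall t, 0 < t -> `|v x - v (x - t)| <= L * (t / (t + 1)).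

(** [J] looks only at the past of [x]. The Steklov means used below come from an antiderivative
    controlled on a left half-line only, so continuity everywhere would ask too much. *)
Definition lcont (v : R -> R) (x : R) := forall y : R, y < x -> {for y, continuous v}.

Definition J (q v : R -> R) (x : R) : R := hintegral (fun t => q t * (v x - v (x - t))).

Lemma pcont_diff (q v : R -> R) (x : R) : pcont q -> lcont v x ->
  pcont (fun t => q t * (v x - v (x - t))).
Proof.
move=> cq cv t t0; apply: contM; first exact: cq.
apply: contB; first exact: cont_cst.
by apply: cont_shift; apply: cv; rewrite ltrBlDr ltrDl.
Qed.

Lemma hintegrableJ (q v : R -> R) (x : R) : adm q -> lcont v x -> tame v x ->
  hintegrable (fun t => q t * (v x - v (x - t))).
Proof.
move=> [cq [C qC]] cv [L vL].
have [hd _] := hintegrable_hintegral_dom a0 a1 ltr01.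
apply: (hintegrable_dom _ (hintegrableZ (C * L) hd)); first exact: pcont_diff.
move=> t t0.
rewrite normrM (le_trans (ler_pM _ _ (qC t t0) (vL t t0)))//.
rewrite le_eqVlt; apply/orP; left; apply/eqP; field.
by rewrite !gt_eqF ?addr_gt0.
Qed.

Lemma adm_nuk : adm (nuk a).
Proof.
split; first exact: pcont_nuk.
exists a => t t0; rewrite ger0_norm//; exact: ltW (nuk_gt0 a0 t0).
Qed.

Lemma adm_lin (c : R) (q1 q2 : R -> R) : adm q1 -> adm q2 ->
  adm (fun t => q1 t - c * q2 t).
Proof.
move=> [c1 [C1 h1]] [c2 [C2 h2]]; split.
  by move=> t t0; apply: contB; [exact: c1|apply: contZ; exact: c2].
exists (C1 + `|c| * C2) => t t0; rewrite (le_trans (ler_normB _ _))//.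
by rewrite mulrDl lerD ?h1// normrM -mulrA ler_wpM2l ?h2.
Qed.

Lemma tame_lin (c : R) (v1 v2 : R -> R) (x : R) : tame v1 x -> tame v2 x ->
  tame (fun y => v1 y - c * v2 y) x.
Proof.
move=> [L1 h1] [L2 h2]; exists (L1 + `|c| * L2) => t t0.
rewrite (_ : _ - _ = v1 x - v1 (x - t) - c * (v2 x - v2 (x - t))); last by ring.
rewrite (le_trans (ler_normB _ _))// mulrDl lerD ?h1// normrM -mulrA.
by rewrite ler_wpM2l ?h2.
Qed.

Lemma J_linr (q v1 v2 : R -> R) (c x : R) : adm q -> lcont v1 x ->
  lcont v2 x -> tame v1 x -> tame v2 x ->
  J q (fun y => v1 y - c * v2 y) x = J q v1 x - c * J q v2 x.
Proof.
move=> hq c1 c2 t1 t2.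
have k1 := hintegrableJ hq c1 t1; have k2 := hintegrableJ hq c2 t2.
rewrite /J -(hintegralZ c k2) -(hintegralB k1 (hintegrableZ c k2)).
by apply: eq_hintegral => t _; ring.
Qed.

Lemma J_subr (q v : R -> R) (k x : R) : adm q -> lcont v x -> tame v x ->
  J q (fun y => k - v y) x = - J q v x.
Proof.
move=> hq cv tv; have ok := hintegrableJ hq cv tv.
by rewrite -mulN1r -(hintegralZ _ ok); apply: eq_hintegral => t _; ring.
Qed.

Lemma J_linl (q1 q2 v : R -> R) (c x : R) : adm q1 -> adm q2 ->
  lcont v x -> tame v x ->
  J (fun t => q1 t - c * q2 t) v x = J q1 v x - c * J q2 v x.
Proof.
move=> h1 h2 cv tv.
have k1 := hintegrableJ h1 cv tv; have k2 := hintegrableJ h2 cv tv.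
rewrite /J -(hintegralZ c k2) -(hintegralB k1 (hintegrableZ c k2)).
by apply: eq_hintegral => t _; ring.
Qed.

Lemma J_shift (q v : R -> R) (s x : R) : J q (fun y => v (y + s)) x = J q v (x + s).
Proof. by apply: eq_hintegral => t _; rewrite addrAC. Qed.

Lemma tame_shift (v : R -> R) (s x : R) : tame v (x + s) -> tame (fun y => v (y + s)) x.
Proof. by move=> [L h]; exists L => t t0; rewrite addrAC; exact: h. Qed.

(* Integration by parts from the kernel [q] to the kernel [- q^`()]. *)
Lemma J_IBP (q q' v dv : R -> R) (x C : R) : adm q' ->
  (forall t : R, 0 < t -> der q t (- q' t)) ->
  (forall t, 0 < t -> `|q t| <= C * pk a t) ->
  (forall y : R, y < x -> der v y (dv y)) -> lcont dv x -> tame v x ->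
  hintegrable (fun t => q t * dv (x - t)) ->
  hintegral (fun t => q t * dv (x - t)) = J q' v x.
Proof.
move=> hq' dq qC dvv cdv tv hok1.
have cv : lcont v x by move=> y /dvv; exact: der_cont.
have hokv := hintegrableJ hq' cv tv.
have cq : pcont q by move=> t t0; exact: der_cont (dq t t0).
pose F t := q t * (v x - v (x - t)).
have dF (t : R) : 0 < t ->
    der F t (q t * dv (x - t) - q' t * (v x - v (x - t))).
  move=> t0; have xt : x - t < x by rewrite ltrBlDr ltrDl.
  refine (derE (derM (dq t t0) (derB (der_cst (v x) t) (der_shift (dvv _ xt)))) _).
  by ring.
have [L hL] := tv.
have L0 : 0 <= L.
  have := hL 1 ltr01; move/(le_trans (normr_ge0 _)).
  by rewrite pmulr_lge0 ?divr_gt0.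
have C0 : 0 <= C.
  by have := qC 1 ltr01; move/(le_trans (normr_ge0 _)); rewrite pmulr_lge0 ?pk_gt0.
(* The boundary terms: near [0] the increment is at most [L * t], so [F] is [O(t^(1 - a))]; at
   infinity it is at most [L], so [F] is [O(t^(- a))]. *)
have F1 (t : R) : 0 < t -> `|F t| <= C * L * (t * pk a t).
  move=> t0; rewrite normrM (le_trans (ler_pM _ _ (qC t t0) (hL t t0)))//.
  rewrite mulrACA ler_wpM2l ?mulr_ge0// mulrC ler_pM2r ?pk_gt0//.
  by rewrite ler_pdivrMr ?addr_gt0// mulrDr mulr1 lerDr mulr_ge0 ?ltW.
have F2 (t : R) : 0 < t -> `|F t| <= C * L * pk a t.
  move=> t0; rewrite normrM (le_trans (ler_pM _ _ (qC t t0) (hL t t0)))//.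
  rewrite mulrACA ler_wpM2l ?mulr_ge0// ler_piMr ?(ltW (pk_gt0 _ _))//.
  by rewrite ler_pdivrMr ?addr_gt0// mul1r lerDl.
have F0 : F t @[t --> 0^'+] --> 0.
  apply: (@cvg0_le _ _ _ _ _ (fun t => C * L * (t * pk a t))).
    by near=> t; apply: F1.
  by rewrite -[X in _ --> X](mulr0 (C * L)); apply: cvgMl_tmp; exact: tpk_cvg0.
have Fy : F t @[t --> +oo] --> 0.
  apply: (@cvg0_le _ _ _ _ _ (fun t => C * L * pk a t)).
    by near=> t; apply: F2; near: t; exact: nbhs_pinfty_gt.
  by rewrite -[X in _ --> X](mulr0 (C * L)); apply: cvgMl_tmp; exact: pk_cvgy.
apply/eqP; rewrite -subr_eq0 /J -hintegralB//.
rewrite (hFTC _ _ dF F0 Fy) ?subrr//; first exact: hintegrableB.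
move=> t t0; apply: contB; last by apply: pcont_diff => //; exact: hq'.1.
apply: contM; [exact: cq|apply: cont_shift; apply: cdv].
by rewrite ltrBlDr ltrDl.
Unshelve. all: by end_near. Qed.

(** Reflection [z = x - t], then integration by parts with [q = pk a]. The hypothesis
    [frac_deriv_defined] supplies the integrability that the second step asks for, so that no junk
    value of the integral enters. *)
Lemma frac_deriv_J (v : R -> R) (x : R) : (forall y, derivable v y 1) ->
  continuous (derive1 v) -> tame v x -> frac_deriv_defined a v x ->
  frac_deriv a v x = (Gamma (1 - a))^-1 * J (nuk a) v x.
Proof.
move=> dv cdv tv def; congr (_ * _).
pose F t := pk a t * derive1 v (x - t).
have [hF <-] : hintegrable F /\ hintegral F =
    \int[lebesgue_measure]_(z in `]-oo, x[) frac_deriv_kernel a v x z.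
  apply: hintegrable_hintegral_reflect def.
    apply: measurable_funM; first exact: measurable_powR.
    apply: continuous_measurable_fun => t.
    by apply: cont_shift; exact: cdv.
  move=> z zx; rewrite /F /frac_deriv_kernel /pk powRN mulrC.
  by congr (derive1 v _ / _); ring.
apply: (@J_IBP _ _ _ _ _ 1) => //.
- exact: adm_nuk.
- by move=> t t0; exact: der_pk.
- by move=> t t0; rewrite mul1r ger0_norm// ltW// pk_gt0.
- by move=> y _; exact: derivable_der.
- by move=> y _; exact: cdv.
Qed.

End marchaud.

(** * Limits under the integral sign and antiderivatives *)

Section convergence.
Context {R : realType}.
Notation mu := (@lebesgue_measure R).

(** The bounds are asked for large [n] only, because difference quotients are controlled for small
    steps only; a shift by [N] leads back to the usual dominated convergence. *)
Lemma hintegral_dcvg (f_ : nat -> R -> R) (f g : R -> R) : hintegrable g -> pcont f ->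
  (\forall n \near \oo, pcont (f_ n) /\ forall t, 0 < t -> `|f_ n t| <= g t) ->
  (forall t, 0 < t -> f_ n t @[n --> \oo] --> f t) ->
  hintegral (f_ n) @[n --> \oo] --> hintegral f.
Proof.
move=> hg cf [N _ hN] ff; rewrite -(cvg_shiftn N).
have hNn n : pcont (f_ (n + N)) /\ forall t, 0 < t -> `|f_ (n + N) t| <= g t.
  by apply: hN; exact: leq_addl.
have okn n : hintegrable (f_ (n + N)) by have [? ?] := hNn n; exact: hintegrable_dom hg _.
have okf : hintegrable f.
  apply: (hintegrable_dom cf hg) => t t0.
  have h : `|f_ (n + N) t| @[n --> \oo] --> `|f t|.
    by apply: cvg_norm; rewrite (cvg_shiftn N (fun n => f_ n t)); exact: ff.
  apply: (cvgr_to_le h); apply: nearW => n.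
  by have [_] := hNn n; apply.
apply: fine_cvg; rewrite fineK; last exact: integrable_fin_num.
apply: (@dominated_cvg _ _ _ mu _ _ (fun n x => (f_ (n + N) x)%:E) _ (EFin \o g)) => //=.
- by move=> n; apply/measurable_EFinP; apply: pcont_measurable; case: (hNn n).
- move=> t; rewrite in_itv/= andbT => t0.
  apply: cvg_EFin; first exact: nearW.
  by rewrite (cvg_shiftn N (fun n => f_ n t)); exact: ff.
- move=> n t; rewrite in_itv/= andbT => t0.
  by rewrite lee_fin; have [_] := hNn n; apply.
Qed.

(** An integral with a variable upper limit reaches only points to the right of its base point.
    Integrating the reflected function from [- c] covers the whole half-line to the left of [c]. *)
Lemma left_antiderivative (w : R -> R) (c : R) : continuous w ->
  exists W : R -> R, forall y, y < c -> der W y (w y).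
Proof.
move=> cw; pose r s := w (0 - s).
have cr : continuous r by move=> s; apply: cont_shift; exact: cw.
pose P s := \int[mu]_(t in `[- c, s]) r t.
have dP (s : R) : - c < s -> der P s (r s).
  move=> cs; have [] := @continuous_FTC1_closed R r (- c) s (s + 1) _ _ cs (cr s).
  - by rewrite ltrDl.
  - apply: continuous_compact_integrable; first exact: segment_compact.
    exact: continuous_subspaceT.
  by move=> /derivable_der h E; exact: derE h E.
exists (fun y => - P (0 - y)) => y yc.
have cy : - c < 0 - y by rewrite sub0r ltrN2.
refine (derE (derN (der_shift (dP _ cy))) _).
by rewrite opprK /r !sub0r opprK.
Qed.

End convergence.

(** * Convolution with the kernel [b] *)

Section kernel_operator.
Context {R : realType}.
Variables (a l : R) (b : R -> R).
Hypothesis kb : laplace_kernel a l b.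

Let a0 : 0 < a. Proof. by case: kb => -[]. Qed.
Let a1 : a < 1. Proof. by case: kb => -[]. Qed.
Let l0 : 0 < l. Proof. by case: kb => -[]. Qed.
Let db (t : R) : 0 < t -> der b t (l * b t - nuk a t).
Proof. by case: kb => _ + _ _ _; apply. Qed.
Let b0 (t : R) : 0 < t -> 0 <= b t.
Proof. by case: kb => _ _ + _ _; apply. Qed.
Let b1 (t : R) : 0 < t -> b t <= a * (pk a t / (l * t + a)).
Proof. by case: kb => _ _ _ + _; apply. Qed.
Let okb : hintegrable b. Proof. by case: kb => _ _ _ _ []. Qed.
Let hbe : hintegral b = hintegral (ek a l). Proof. by case: kb => _ _ _ _ []. Qed.

Definition bconv (v : R -> R) (x : R) : R := hintegral b * v x - J b v x.
Notation D := (J (nuk a)).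
Notation kap := (l * hintegral b).

Let la (t : R) : 0 < t -> 0 < l * t + a.
Proof. by move=> t0; rewrite addr_gt0// mulr_gt0. Qed.

Lemma hintegral_b_gt0 : 0 < hintegral b.
Proof.
rewrite hbe; apply: hintegral_gt0.
- exact: pcont_ek.
- exact: hintegrable_ek.
- by move=> t; exact: ek_gt0.
Qed.

Lemma adm_b : adm a b.
Proof.
split; first by move=> t t0; exact: der_cont (db t0).
exists (a / l) => t t0; rewrite ger0_norm ?b0// (le_trans (b1 t0))//.
rewrite (_ : a / l * (pk a t / t) = a * (pk a t / (l * t))); last first.
  by field; rewrite !gt_eqF.
rewrite ler_pM2l// ler_pM2l ?pk_gt0// lef_pV2 ?posrE ?la ?mulr_gt0//.
by rewrite lerDl ltW.
Qed.

(** Since [nuk a - l * b] is [- b'], this rearrangement of the upper bound on [b] says that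
    [t^a * b t] is nonincreasing. It lets [- b'] dominate [b] on bounded intervals. *)
Lemma b_rate (t : R) : 0 < t -> a * b t <= t * (nuk a t - l * b t).
Proof.
move=> t0; have := b1 t0; rewrite mulrA ler_pdivlMr ?la// => h.
rewrite mulrBr -subr_ge0 (_ : _ - _ = a * pk a t - b t * (l * t + a)).
  by rewrite subr_ge0.
by rewrite /nuk; field; rewrite gt_eqF.
Qed.

Lemma b_le_nuk (t : R) : 0 < t -> 0 <= nuk a t - l * b t.
Proof.
move=> t0; rewrite -(pmulr_rge0 _ t0); apply: le_trans (b_rate t0).
by rewrite mulr_ge0 ?b0// ltW.
Qed.

Notation q' := (fun t => nuk a t - l * b t).

Lemma adm_q' : adm a q'.
Proof. by apply: adm_lin; [exact: adm_nuk|exact: adm_b]. Qed.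

Lemma J_q' (v : R -> R) (x : R) : lcont v x -> tame v x ->
  J q' v x = l * bconv v x - (kap * v x - D v x).
Proof.
move=> cv tv; rewrite (@J_linl _ _ a0 a1 _ _ _ l _ (adm_nuk a0) adm_b cv tv) /bconv.
by ring.
Qed.

(* The weight [b] is dominated by [(T / a) q'] on [(0, T)], and by a small
   integrable tail beyond [T]; at a point where [v] takes its largest absolute
   value both differences [v x - v (x - t)] are nonnegative. *)
Lemma record_bound : exists c1 c2 c3 : R, [/\ 0 < c1, 0 < c2, 0 < c3 &
  forall (v : R -> R) (x : R), lcont v x -> tame v x ->
    (forall z, z <= x -> `|v z| <= v x) ->
    c1 * v x <= c2 * bconv v x - c3 * (kap * v x - D v x)].
Proof.
have K0 := hintegral_b_gt0.
(* [T] makes the tail beyond it absorb half of [hintegral b * v x]. The [4] collects the bound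
   [2 * v x] on the increments and [t >= (t + T) / 2] for [t > T]; [a / l] comes from
   [b t <= a / l * (pk a t / t)]. *)
have [T [T0 hT]] : exists T : R, 0 < T /\ 4 * (a / l) * (domC a * pk a T) <= hintegral b / 2.
  have h : 4 * (a / l) * (domC a * pk a T) @[T --> +oo] --> 0.
    rewrite -[X in _ --> X](mulr0 (4 * (a / l))); apply: cvgMl_tmp.
    rewrite -[X in _ --> X](mulr0 (domC a)); apply: cvgMl_tmp.
    exact: pk_cvgy.
  near (pinfty_nbhs R) => T; exists T; split.
    by near: T; exact: nbhs_pinfty_gt.
  by apply/ltW; near: T; apply: (cvgr_lt _ h); rewrite divr_gt0.
have Ta0 : 0 < T / a by rewrite divr_gt0.
exists (hintegral b / 2), (1 + T / a * l), (T / a); split => //.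
- by rewrite divr_gt0.
- by rewrite addr_gt0// mulr_gt0.
move=> v x cv tv hv; set m := v x.
have m0 : 0 <= m by exact: le_trans (normr_ge0 _) (hv x (lexx x)).
have y0 (t : R) : 0 < t -> 0 <= m - v (x - t) <= 2 * m.
  move=> t0; have := hv (x - t); rewrite lerBlDr lerDl (ltW t0) => /(_ isT).
  by rewrite -/m ler_norml => /andP[h1 h2]; apply/andP; split; lra.
have okE := hintegrableJ a0 a1 adm_b cv tv.
have okq := hintegrableJ a0 a1 adm_q' cv tv.
have [okd intd] := hintegrable_hintegral_dom a0 a1 T0.
have pt (t : R) : 0 < t -> b t * (m - v (x - t)) <=
    T / a * (q' t * (m - v (x - t))) + 4 * (a / l) * m * (pk a t / (t + T)).
  move=> t0; have /andP[yp y2] := y0 t t0.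
  have t20 : 0 <= 4 * (a / l) * m * (pk a t / (t + T)).
    by rewrite !mulr_ge0 ?invr_ge0 ?(ltW a0) ?(ltW l0) ?(ltW (pk_gt0 _ _)) ?(ltW (addr_gt0 _ _)).
  have q0 := b_le_nuk t0.
  have [tT|Tt] := leP t T.
    rewrite -[leLHS]addr0 lerD// mulrA ler_wpM2r//.
    rewrite mulrAC ler_pdivlMr// mulrC (le_trans (b_rate t0))//.
    by rewrite ler_wpM2r.
  have t10 : 0 <= T / a * (q' t * (m - v (x - t))).
    by rewrite mulr_ge0 ?(ltW Ta0)// mulr_ge0.
  rewrite -[leLHS]add0r lerD//.
  apply: (@le_trans _ _ (a / l * (pk a t / t) * (2 * m))).
    apply: ler_pM => //; first exact: b0.
    rewrite (le_trans (b1 t0))//.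
    rewrite (_ : a / l * (pk a t / t) = a * (pk a t / (l * t))); last first.
      by field; rewrite !gt_eqF.
    rewrite ler_pM2l// ler_pM2l ?pk_gt0// lef_pV2 ?posrE ?la ?mulr_gt0//.
    by rewrite lerDl ltW.
  rewrite (_ : 4 * _ * _ * _ = a / l * (pk a t / ((t + T) / 2)) * (2 * m)); last first.
    field; rewrite !gt_eqF ?addr_gt0//.
  rewrite ler_wpM2r ?mulr_ge0// ler_pM2l ?divr_gt0// ler_pM2l ?pk_gt0//.
  rewrite lef_pV2 ?posrE ?divr_gt0 ?addr_gt0//; lra.
have := hintegral_le okE (hintegrableD (hintegrableZ (T / a) okq)
  (hintegrableZ (4 * (a / l) * m) okd)) pt.
rewrite (hintegralD (hintegrableZ _ okq) (hintegrableZ _ okd)) (hintegralZ _ okq) (hintegralZ _ okd).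
rewrite -/(J b v x) -/(J q' v x) (J_q' cv tv) -/m.
rewrite (_ : J b v x = hintegral b * m - bconv v x); last by rewrite /bconv /m; ring.
set Av := bconv v x; set P := kap * m - D v x => h1.
have h2 : 4 * (a / l) * m * hintegral (fun t => pk a t / (t + T)) <= hintegral b / 2 * m.
  rewrite mulrAC ler_wpM2r// (le_trans _ hT)// ler_pM2l// !mulr_gt0// invr_gt0//.
move: h1 h2; set I := _ * hintegral _; set Ta := T / a => h1 h2.
have -> : (1 + Ta * l) * Av - Ta * P = Av + Ta * (l * Av - P) by ring.
have : hintegral b * m = hintegral b / 2 * m + hintegral b / 2 * m by field.
lra.
Unshelve. all: by end_near. Qed.

Lemma tame_bound (v : R -> R) (x L S : R) : 0 <= L -> 0 <= S ->
  (forall t, 0 < t -> t <= 1 -> `|v x - v (x - t)| <= L * t) ->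
  (forall t, 1 < t -> `|v x - v (x - t)| <= S) ->
  forall t, 0 < t -> `|v x - v (x - t)| <= 2 * (L + S) * (t / (t + 1)).
Proof.
move=> L0' S0' h1 h2 t t0; have t10 : 0 < t + 1 by rewrite addr_gt0.
rewrite mulrA ler_pdivlMr//.
have [t1|t1] := leP t 1.
  apply: (@le_trans _ _ (L * t * (t + 1))); first by rewrite ler_pM2r// h1.
  rewrite (_ : 2 * (L + S) * t = L * t * 2 + 2 * S * t); last by ring.
  by rewrite -[leLHS]addr0 lerD ?mulr_ge0 ?ler_wpM2l ?mulr_ge0 ?(ltW t0)//; lra.
apply: (@le_trans _ _ (S * (t + 1))); first by rewrite ler_pM2r// h2.
rewrite (_ : 2 * (L + S) * t = S * (2 * t) + 2 * L * t); last by ring.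
by rewrite -[leLHS]addr0 lerD ?mulr_ge0 ?ler_wpM2l ?(ltW t0)//; lra.
Qed.

Lemma bconvE (v : R -> R) (x : R) : lcont v x -> tame v x ->
  hintegrable (fun t => b t * v (x - t)) /\ bconv v x = hintegral (fun t => b t * v (x - t)).
Proof.
move=> cv tv; have okE := hintegrableJ a0 a1 adm_b cv tv.
have h (t : R) : 0 < t -> v x * b t - b t * (v x - v (x - t)) = b t * v (x - t).
  by move=> _; ring.
split; first exact: eq_hintegrable h (hintegrableB (hintegrableZ (v x) okb) okE).
by rewrite -(eq_hintegral h) (hintegralB (hintegrableZ (v x) okb) okE) (hintegralZ _ okb) mulrC.
Qed.

(* [(bconv w (x + h) - bconv w x) / h] is, by parts, the operator with kernel [q']
   applied to the Steklov mean [(1 / h) \int_y^(y + h) w] of [w]. *)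
Lemma der_bconv (w : R -> R) (x L S : R) : continuous w ->
  (forall y z, x - 2 <= y -> y <= x + 1 -> x - 2 <= z -> z <= x + 1 ->
     `|w y - w z| <= L * `|y - z|) ->
  (forall y, y <= x + 1 -> `|w y| <= S) ->
  der (bconv w) x (l * bconv w x - (kap * w x - D w x)).
Proof.
move=> cw lipw bdw.
have S0 : 0 <= S by apply: le_trans (normr_ge0 _) (bdw x _); rewrite lerDl.
have L0 : 0 <= L.
  have := lipw x (x - 1); rewrite subKr normr1 mulr1 => h.
  by apply: le_trans (normr_ge0 _) (h _ _ _ _); lra.
have [W dW] := left_antiderivative (x + 2) cw.
have cwl y : lcont w y by move=> z _; exact: cw.
have bdw2 y z : y <= x + 1 -> z <= x + 1 -> `|w y - w z| <= 2 * S.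
  move=> hy hz; rewrite (le_trans (ler_normB _ _))//.
  by have := bdw y hy; have := bdw z hz; lra.
have tamew y : x - 1 <= y -> y <= x + 1 -> tame w y.
  move=> y1 y2; exists (2 * (L + 2 * S)); apply: tame_bound => //.
  - by rewrite mulr_ge0.
  - move=> t t0 t1; have := lipw y (y - t).
    by rewrite subKr (gtr0_norm t0); apply; lra.
  - by move=> t t1; apply: bdw2; lra.
apply: der_lim => u un u0.
rewrite -(J_q' (cwl x) (tamew x _ _)); [|by lra..].
have u1 : \forall n \near \oo, `|u n| < 1.
  have h : `|u n| @[n --> \oo] --> 0 by rewrite -(normr0 R); exact: cvg_norm.
  exact: (cvgr_lt _ h).
(* The Steklov mean inherits from [w] the bound [S] and, near [x], the Lipschitz constant [L]: the
   window from [x - 2] to [x + 1] contains [x - t + h] for [t <= 1] and [|h| < 1]. Its tame constant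
   is thus independent of [h], which provides the majorant for the limit. *)
pose vh (h y : R) := (W (y + h) - W y) / h.
pose dvh (h y : R) := (w (y + h) - w y) / h.
have dvhE (h y : R) : `|h| < 1 -> y <= x -> der (vh h) y (dvh h y).
  move=> h1 yx; have hh := ltr_norml h 1; rewrite h1 in hh; have /andP[h2 h3] := esym hh.
  have yh : y + h < x + 2 by lra.
  have yx2 : y < x + 2 by lra.
  have dsh : der (fun y => y + h) y 1.
    by refine (derE (derD (der_id y) (der_cst h y)) _); rewrite addr0.
  refine (derE (derM (derB (der_comp dsh (dW _ yh)) (dW _ yx2)) (der_cst h^-1 y)) _).
  by rewrite mulr1 mulr0 addr0.
have vhS (h y : R) : h != 0 -> `|h| < 1 -> y <= x -> `|vh h y| <= S.
  move=> h0 h1 yx; have hh := ltr_norml h 1; rewrite h1 in hh; have /andP[h2 h3] := esym hh.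
  rewrite /vh normrM normfV ler_pdivrMr ?normr_gt0//.
  have -> : `|h| = `|y + h - y| by rewrite addrC addKr.
  apply: (@der_bound _ W w) => z; rewrite ge_min le_max => /andP[_ zz].
    by apply: dW; case/orP : zz; lra.
  by apply: bdw; case/orP : zz; lra.
have vhL (h t : R) : h != 0 -> `|h| < 1 -> 0 < t -> t <= 1 ->
    `|vh h x - vh h (x - t)| <= L * t.
  move=> h0 h1 t0 t1; have hh := ltr_norml h 1; rewrite h1 in hh; have /andP[h2 h3] := esym hh.
  have {2}-> : t = `|x - (x - t)| by rewrite subKr gtr0_norm.
  have xt : x - t <= x by rewrite lerBlDr lerDl ltW.
  apply: (@der_bound _ (vh h) (dvh h)) => z; rewrite (min_idPr xt) (max_idPl xt) => /andP[z1 z2].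
    exact: dvhE.
  rewrite /dvh normrM normfV ler_pdivrMr ?normr_gt0//.
  have -> : `|h| = `|z + h - z| by rewrite addrC addKr.
  by apply: lipw; lra.
have vhT (h : R) : h != 0 -> `|h| < 1 -> forall t : R, 0 < t ->
    `|vh h x - vh h (x - t)| <= 2 * (L + 2 * S) * (t / (t + 1)).
  move=> h0 h1; apply: tame_bound => //; first by rewrite mulr_ge0.
  - by move=> t; exact: vhL.
  - move=> t t1; rewrite (le_trans (ler_normB _ _))//.
    have e1 := vhS h x h0 h1 (lexx x).
    have e2 : `|vh h (x - t)| <= S by apply: vhS => //; lra.
    lra.
have cvh (h : R) : `|h| < 1 -> lcont (vh h) x.
  by move=> h1 y yx; exact: der_cont (dvhE h y h1 (ltW yx)).
have key n : `|u n| < 1 -> (bconv w (x + u n) - bconv w x) / u n = J q' (vh (u n)) x.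
  move=> h1; have hh := ltr_norml (u n) 1; rewrite h1 in hh; have /andP[h2 h3] := esym hh.
  have tx : tame w x by apply: tamew; lra.
  have txu : tame w (x + u n) by apply: tamew; lra.
  have [k1 ->] := bconvE (cwl x) tx.
  have [k2 ->] := bconvE (cwl (x + u n)) txu.
  have e (t : R) : 0 < t -> (u n)^-1 * (b t * w (x + u n - t) - b t * w (x - t)) =
      b t * dvh (u n) (x - t).
    by move=> _; rewrite /dvh (addrAC x (u n)); field; exact: un.
  have k3 := eq_hintegrable e (hintegrableZ (u n)^-1 (hintegrableB k2 k1)).
  rewrite mulrC -(hintegralB k2 k1) -(hintegralZ _ (hintegrableB k2 k1)) (eq_hintegral e).
  apply: (@J_IBP _ a a0 a1 b q' (vh (u n)) (dvh (u n)) x 1) => //.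
  - exact: adm_q'.
  - by move=> t t0; refine (derE (db t0) _); rewrite opprB.
  - move=> t t0; rewrite ger0_norm ?b0// mul1r (le_trans (b1 t0))//.
    rewrite mulrCA ger_pMr ?pk_gt0// ler_pdivrMr ?la// mul1r lerDr.
    by rewrite mulr_ge0 ?ltW.
  - by move=> y yx; apply: dvhE => //; exact: ltW.
  - move=> y yx; apply: contM; last exact: cont_cst.
    apply: contB; last exact: cw.
    apply: (cont_comp w (fun y => y + u n)); last exact: cw.
    by apply: contD; [exact: cont_id|exact: cont_cst].
  - by exists (2 * (L + 2 * S)); exact: vhT.
have lim : J q' (vh (u n)) x @[n --> \oo] --> J q' w x.
  have [cq [C qC]] := adm_q'.
  have [okd _] := hintegrable_hintegral_dom a0 a1 ltr01.
  apply: (hintegral_dcvg (hintegrableZ (C * (2 * (L + 2 * S))) okd)).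
  - exact: pcont_diff.
  - near=> n.
    have n1 : `|u n| < 1 by near: n.
    split; first by apply: pcont_diff => //; exact: cvh.
    move=> t t0; rewrite normrM (le_trans (ler_pM _ _ (qC t t0) (vhT _ (un n) n1 t t0)))//.
    rewrite le_eqVlt; apply/orP; left; apply/eqP; field.
    by rewrite !gt_eqF ?addr_gt0.
  - move=> t t0; apply: cvgMl_tmp; apply: cvgB.
      by apply: der_seq => //; apply: dW; lra.
    by apply: der_seq => //; apply: dW; lra.
apply: cvg_trans lim; apply: near_eq_cvg; near=> n; rewrite key//.
by near: n.
Unshelve. all: by end_near. Qed.


End kernel_operator.

(** * Functions with limits at infinity *)

Section real_functions.
Context {R : realType}.

Lemma nearNy_le (P : R -> Prop) : (\forall x \near -oo, P x) ->
  exists M : R, forall x, x <= M -> P x.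
Proof.
move=> [M [_ hM]]; exists (M - 1) => x xM; apply: hM.
by rewrite (le_lt_trans xM)// ltrBlDr ltrDl.
Qed.

Lemma neary_ge (P : R -> Prop) : (\forall x \near +oo, P x) ->
  exists M : R, forall x, M <= x -> P x.
Proof.
move=> [M [_ hM]]; exists (M + 1) => x xM; apply: hM.
by rewrite (lt_le_trans _ xM)// ltrDl.
Qed.

Lemma le_nearNy (P : R -> Prop) (M : R) : (forall x, x <= M -> P x) ->
  \forall x \near -oo, P x.
Proof. by move=> h; exists M; split; [exact: num_real|move=> x /ltW; exact: h]. Qed.

Lemma attain_max (f : R -> R) (x y : R) : continuous f ->
  f z @[z --> -oo] --> 0 -> y <= x -> 0 < f y ->
  exists x0, [/\ x0 <= x, 0 < f x0 & forall z, z <= x -> f z <= f x0].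
Proof.
move=> cf f0 yx fy.
have [M hM] := nearNy_le (cvgr_lt _ f0 _ fy).
pose M' := Num.min M y.
have M'x : M' <= x by rewrite ge_min yx orbT.
have [|c] := @EVT_max R f M' x M'x.
  exact: continuous_subspaceT.
rewrite in_itv/= => /andP[c1 c2] hc.
have yc : f y <= f c by apply: hc; rewrite in_itv/= yx ge_min lexx orbT.
exists c; split => //; first exact: lt_le_trans fy yc.
move=> z zx; have [zM|zM] := leP M' z; first by apply: hc; rewrite in_itv/= zM.
apply: le_trans yc; apply/ltW/hM; apply: (le_trans (ltW zM)).
by rewrite ge_min lexx.
Qed.

Lemma continuous_norm (f : R -> R) : continuous f -> continuous (fun x => `|f x|).
Proof. by move=> cf x; apply: cvg_norm; exact: cf. Qed.

Lemma bounded_segment (f : R -> R) (u v : R) : u <= v -> continuous f ->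
  exists S, forall x, u <= x -> x <= v -> `|f x| <= S.
Proof.
move=> uv cf; have [|c _ hc] := @EVT_max R (fun x => `|f x|) u v uv.
  by apply: continuous_subspaceT; exact: continuous_norm.
by exists `|f c| => x x1 x2; apply: hc; rewrite in_itv/= x1.
Qed.

Lemma bounded_limits (f : R -> R) (l1 l2 : R) : continuous f ->
  f x @[x --> -oo] --> l1 -> f x @[x --> +oo] --> l2 ->
  exists S, forall x, `|f x| <= S.
Proof.
move=> cf f1 f2.
have n1 : `|l1| < `|l1| + 1 by rewrite ltrDl.
have n2 : `|l2| < `|l2| + 1 by rewrite ltrDl.
have [M hM] := nearNy_le (cvgr_lt _ (cvg_norm f1) _ n1).
have [N hN] := neary_ge (cvgr_lt _ (cvg_norm f2) _ n2).
have MN : Num.min M N <= Num.max M N by rewrite ge_min le_max lexx.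
have [S hS] := bounded_segment MN cf.
exists (Num.max S (Num.max (`|l1| + 1) (`|l2| + 1))) => x; rewrite !le_max.
have [xM|Mx] := leP x M; first by rewrite (ltW (hM _ xM)) orbT.
have [xN|Nx] := leP N x; first by rewrite (ltW (hN _ xN)) !orbT.
by rewrite hS// ?ge_min ?le_max ?(ltW Mx) ?(ltW Nx) ?orbT.
Qed.

Lemma lipschitz_segment (f df : R -> R) (u v : R) : u <= v ->
  (forall y : R, der f y (df y)) -> continuous df ->
  exists L, forall y z, u <= y -> y <= v -> u <= z -> z <= v ->
    `|f y - f z| <= L * `|y - z|.
Proof.
move=> uv dff cdf; have [S hS] := bounded_segment uv cdf.
exists S => y z y1 y2 z1 z2; apply: (@der_bound _ f df) => // t.
rewrite ge_min le_max => /andP[t1 t2]; apply: hS.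
  by case/orP : t1; apply: le_trans.
by case/orP : t2 => h; apply: (le_trans h).
Qed.

Lemma der_max (f : R -> R) (df x y : R) : der f x df -> x < y ->
  (forall z, z <= y -> exists d : R, der f z d) ->
  (forall z, z <= y -> f z <= f x) -> df = 0.
Proof.
move=> dfx xy hd hm.
have x1 : x - 1 <= y by lra.
have h : is_derive x 1 f 0.
  apply: (@derive1_at_max R f (x - 1) y x x1).
  - move=> t; rewrite in_itv/= => /andP[_ ty].
    by have [d []] := hd t (ltW ty).
  - by rewrite in_itv/= xy ltrBlDr ltrDl ltr01.
  - by move=> t; rewrite in_itv/= => /andP[_ /ltW ty]; exact: hm.
by have [_ <-] := dfx; have [_ ->] := h.
Qed.

Lemma expRM_cvgNy (l : R) : 0 < l -> expR (l * x) @[x --> -oo] --> 0.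
Proof.
move=> l0; apply/cvgrPdist_le => e e0.
exists (ln e / l); split; first exact: num_real.
move=> x xe; rewrite sub0r normrN ger0_norm ?expR_ge0//.
rewrite -[leRHS](lnK e0) ler_expR mulrC -ler_pdivlMr//; exact: ltW.
Qed.

End real_functions.

(** * Records of both signs and the exponential solution *)

Section left_tail.
Context {R : realType}.
Variables (a l : R) (b : R -> R).
Hypothesis kb : laplace_kernel a l b.

Let a0 : 0 < a. Proof. by case: kb => -[]. Qed.
Let a1 : a < 1. Proof. by case: kb => -[]. Qed.
Let l0 : 0 < l. Proof. by case: kb => -[]. Qed.
Let b0 (t : R) : 0 < t -> 0 <= b t.
Proof. by case: kb => _ _ + _ _; apply. Qed.
Let okb : hintegrable b. Proof. by case: kb => _ _ _ _ []. Qed.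
Let hbe : hintegral b = hintegral (ek a l). Proof. by case: kb => _ _ _ _ []. Qed.

Notation A := (bconv b).
Notation D := (J (nuk a)).
Notation kap := (l * hintegral b).

Lemma J_opp (q v : R -> R) (x : R) : adm a q -> lcont v x -> tame v x ->
  J q (fun y => - v y) x = - J q v x.
Proof.
move=> hq cv tv; rewrite -(J_subr a0 a1 0 hq cv tv).
by congr (J q); apply/funext => y; rewrite sub0r.
Qed.

Lemma tame_opp (v : R -> R) (x : R) : tame v x -> tame (fun y => - v y) x.
Proof. by move=> [L h]; exists L => t t0; rewrite -opprD normrN; exact: h. Qed.

Lemma lcont_opp (v : R -> R) (x : R) : lcont v x -> lcont (fun y => - v y) x.
Proof. by move=> cv y yx; apply: cvgN; exact: cv. Qed.

Lemma bconv_opp (v : R -> R) (x : R) : lcont v x -> tame v x ->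
  A (fun y => - v y) x = - A v x.
Proof.
move=> cv tv; rewrite /bconv (J_opp (adm_b kb) cv tv).
by ring.
Qed.

(** The signed versions keep the sign of the residual [kap * v x - D v x], which is [p (w x) >= 0]
    for the profile. The absolute version is for the remainder [w - m * expl l], whose sign is
    unknown. *)
Lemma record_bound_abs : exists c1 c2 c3 : R, [/\ 0 < c1, 0 < c2, 0 < c3 &
  [/\ (forall (v : R -> R) (x : R), lcont v x -> tame v x ->
    (forall z, z <= x -> `|v z| <= v x) ->
    c1 * v x <= c2 * A v x - c3 * (kap * v x - D v x)),
  (forall (v : R -> R) (x : R), lcont v x -> tame v x ->
    (forall z, z <= x -> `|v z| <= - v x) ->
    c1 * - v x <= - c2 * A v x + c3 * (kap * v x - D v x)) &
  (forall (v : R -> R) (x : R), lcont v x -> tame v x ->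
    (forall z, z <= x -> `|v z| <= `|v x|) ->
    c1 * `|v x| <= c2 * `|A v x| + c3 * `|kap * v x - D v x|)]].
Proof.
have [c1 [c2 [c3 [c10 c20 c30 hr]]]] := record_bound kb.
have hrN (v : R -> R) (x : R) : lcont v x -> tame v x ->
    (forall z, z <= x -> `|v z| <= - v x) ->
    c1 * - v x <= - c2 * A v x + c3 * (kap * v x - D v x).
  move=> cv tv hv.
  have := hr _ x (lcont_opp cv) (tame_opp tv).
  rewrite bconv_opp// (J_opp (adm_nuk a0) cv tv) => h.
  rewrite (_ : - c2 * _ + _ = c2 * - A v x - c3 * (kap * - v x - - D v x)).
    by apply: h => z zx; rewrite normrN; exact: hv.
  by ring.
exists c1, c2, c3; split => //; split => // v x cv tv hv.
have e1 : c2 * A v x <= c2 * `|A v x| by rewrite ler_pM2l// ler_norm.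
have e2 : c2 * - A v x <= c2 * `|A v x| by rewrite ler_pM2l// -normrN ler_norm.
set P := kap * v x - D v x.
have e3 : c3 * P <= c3 * `|P| by rewrite ler_pM2l// ler_norm.
have e4 : c3 * - P <= c3 * `|P| by rewrite ler_pM2l// -normrN ler_norm.
have [v0|v0] := leP 0 (v x).
  have := hr v x cv tv; rewrite (ger0_norm v0) -/P => h.
  have {}h : c1 * v x <= c2 * A v x - c3 * P.
    by apply: h => z /hv; rewrite (ger0_norm v0).
  lra.
have := hrN v x cv tv; rewrite (ltr0_norm v0) -/P => h.
have {}h : c1 * - v x <= - c2 * A v x + c3 * P.
  by apply: h => z /hv; rewrite (ltr0_norm v0).
lra.
Qed.

Lemma bconv_bound (v : R -> R) (x s : R) : lcont v x -> tame v x ->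
  (forall z, z < x -> `|v z| <= s) -> `|A v x| <= s * hintegral b.
Proof.
move=> cv tv hv; have [ok ->] := bconvE kb cv tv.
have xt (t : R) : 0 < t -> x - t < x by move=> t0; rewrite ltrBlDr ltrDl.
rewrite ler_norml; apply/andP; split.
  rewrite -mulNr -(hintegralZ (- s) okb); apply: hintegral_le => //; first exact: hintegrableZ.
  move=> t t0; rewrite mulrC ler_wpM2l ?b0//.
  by have := hv _ (xt t t0); rewrite ler_norml => /andP[].
rewrite -(hintegralZ s okb); apply: hintegral_le => //; first exact: hintegrableZ.
move=> t t0; rewrite [leRHS]mulrC ler_wpM2l ?b0//.
by have := hv _ (xt t t0); rewrite ler_norml => /andP[].
Qed.

Definition expl (x : R) : R := expR (l * x).

Lemma expl_der (x : R) : der expl x (l * expl x).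
Proof. exact: der_expZ. Qed.

Lemma expl_gt0 (x : R) : 0 < expl x. Proof. exact: expR_gt0. Qed.

Lemma expl_le (x y : R) : x <= y -> expl x <= expl y.
Proof. by move=> xy; rewrite ler_expR ler_pM2l. Qed.

Lemma expl_cont : continuous expl.
Proof. by move=> x; exact: der_cont (expl_der x). Qed.

Lemma expl_tame (x : R) : tame expl x.
Proof.
exists (2 * (l * expl x + 2 * expl x)) => t t0.
have lx : 0 <= l * expl x by rewrite mulr_ge0 ?(ltW l0) ?(ltW (expl_gt0 x)).
have ex : 0 <= 2 * expl x by rewrite mulr_ge0 ?(ltW (expl_gt0 x)).
apply: tame_bound => //.
- move=> s s0 s1; have {2}-> : s = `|x - (x - s)| by rewrite subKr gtr0_norm.
  have xs : x - s <= x by rewrite lerBlDr lerDl ltW.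
  apply: (@der_bound _ expl (fun y => l * expl y)) => z; first by move=> _; exact: expl_der.
  rewrite (min_idPr xs) (max_idPl xs) => /andP[_ zx].
  by rewrite ger0_norm ?mulr_ge0 ?(ltW l0) ?(ltW (expl_gt0 _))// ler_pM2l// expl_le.
- move=> s s1; have xs : x - s <= x by rewrite lerBlDr lerDl (ltW (lt_trans ltr01 s1)).
  rewrite (le_trans (ler_normB _ _))// !ger0_norm ?(ltW (expl_gt0 _))//.
  by have := expl_le xs; have := expl_gt0 x; lra.
Qed.

Lemma D_expl (x : R) : D expl x = kap * expl x.
Proof.
have hk := hintegrable_ek a0 a1 l0.
have e (t : R) : 0 < t -> l * expl x * ek a l t = pk a t * (l * expl (x - t)).
  by move=> _; rewrite /expl mulrBr expRD -mulNr /ek; ring.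
have ok := eq_hintegrable e (hintegrableZ (l * expl x) hk).
have <- : hintegral (fun t => pk a t * (l * expl (x - t))) = D expl x; last first.
  by rewrite -(eq_hintegral e) (hintegralZ _ hk) -hbe; ring.
apply: (@J_IBP _ a a0 a1 (pk a) (nuk a) expl (fun y => l * expl y) x 1) => //.
- exact: adm_nuk.
- by move=> t t0; exact: der_pk.
- by move=> t t0; rewrite mul1r ger0_norm// ltW// pk_gt0.
- by move=> y _; exact: expl_der.
- by move=> y _; apply: contZ; exact: expl_cont.
- exact: expl_tame.
Qed.

(** The exponential is an eigenfunction by translation. Its residual vanishes and every point is a
    record of it, so the record inequality makes the eigenvalue positive. *)
Lemma bconv_expl : exists2 c : R, 0 < c & forall x, A expl x = c * expl x.
Proof.
have [c1 [c2 [c3 [c10 c20 c30 [hr _ _]]]]] := record_bound_abs.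
have lc x : lcont expl x by move=> y _; exact: expl_cont.
exists (A expl 0).
  have := hr expl 0 (lc 0) (expl_tame 0) _; rewrite D_expl subrr mulr0 subr0 => h.
  have {}h : c1 * expl 0 <= c2 * A expl 0.
    by apply: h => z z0; rewrite ger0_norm ?(ltW (expl_gt0 _))// expl_le.
  rewrite -(pmulr_rgt0 _ c20); apply: lt_le_trans h.
  by rewrite mulr_gt0// expl_gt0.
move=> x; have [ok0 ->] := bconvE kb (lc 0) (expl_tame 0).
have [_ ->] := bconvE kb (lc x) (expl_tame x).
rewrite mulrC -(hintegralZ _ ok0); apply: eq_hintegral => t _.
by rewrite /expl sub0r mulrBr expRD mulrN; ring.
Qed.

End left_tail.

Lemma C1_tame {R : realType} (w dw : R -> R) (S : R) : (forall y : R, der w y (dw y)) ->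
  continuous dw -> (forall x, `|w x| <= S) -> forall x, tame w x.
Proof.
move=> dww cdw hS x.
have xx : x - 1 <= x by lra.
have [L hL] := lipschitz_segment xx dww cdw.
have L0 : 0 <= L.
  have := hL x (x - 1); rewrite subKr normr1 mulr1 => h.
  by apply: le_trans (normr_ge0 _) (h _ _ _ _); lra.
have S0 : 0 <= S by exact: le_trans (normr_ge0 _) (hS x).
exists (2 * (L + 2 * S)); apply: tame_bound => //.
- by rewrite mulr_ge0.
- move=> t t0 t1; have := hL x (x - t).
  by rewrite subKr (gtr0_norm t0); apply; lra.
- move=> t t1; rewrite (le_trans (ler_normB _ _))//.
  by have := hS x; have := hS (x - t); lra.
Qed.

(** * Expansion at [-oo] *)

Section left_asymptotics.
Context {R : realType}.
Variables (a l : R) (b : R -> R).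
Hypothesis kb : laplace_kernel a l b.

Let l0 : 0 < l. Proof. by case: kb => -[]. Qed.

Notation A := (bconv b).
Notation D := (J (nuk a)).
Notation kap := (l * hintegral b).
Notation el := (expl l).

Variables (w dw p : R -> R) (C0 Wp S : R).
Hypothesis dww : forall y : R, der w y (dw y).
Hypothesis cdw : continuous dw.
Hypothesis eqw : forall x, kap * w x - D w x = p (w x).
Hypothesis p0 : forall u, 0 <= p u.
Hypothesis C00 : 0 < C0.
Hypothesis p2 : forall u, `|u| <= 1 -> p u <= C0 * u ^+ 2.
Hypothesis pc : {for Wp, continuous p}.
Hypothesis pW : 0 < p Wp.
Hypothesis wNy : w x @[x --> -oo] --> 0.
Hypothesis wy : w x @[x --> +oo] --> Wp.
Hypothesis hS : forall x, `|w x| <= S.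

Let cw : continuous w.
Proof. by move=> y; exact: der_cont (dww y). Qed.

Let lw x : lcont w x.
Proof. by move=> y _; exact: cw. Qed.

Let tw x : tame w x.
Proof. exact: C1_tame dww cdw hS x. Qed.

Let K0 : 0 < hintegral b.
Proof. exact: (hintegral_b_gt0 kb). Qed.

Lemma dA (x : R) : der (A w) x (l * A w x - p (w x)).
Proof.
have x21 : x - 2 <= x + 1 by lra.
have [L hL] := lipschitz_segment x21 dww cdw.
rewrite -eqw; apply: (der_bconv kb cw hL) => y _; exact: hS.
Qed.

Lemma Adec (x y : R) : x <= y -> el (- y) * A w y <= el (- x) * A w x.
Proof.
move=> xy.
have d (z : R) : der (fun z => el (- z) * A w z) z (- (el (- z) * p (w z))).
  refine (derE (derM (der_comp (derN (der_id z)) (expl_der l (- z))) (dA z)) _).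
  by ring.
have hge := @der_ge _ (fun z => el (- z) * A w z)
  (fun z => - (el (- z) * p (w z))) x y xy (fun z _ => d z).
apply: hge => z _; by rewrite oppr_le0 mulr_ge0// ltW// expl_gt0.
Qed.

Lemma elNM (x : R) : el x * el (- x) = 1.
Proof. by rewrite /expl -expRD -mulrDr subrr mulr0 expR0. Qed.

(* Otherwise [A w] would tend to [-oo] exponentially fast, as [Adec] shows. *)
Lemma A_ge0 (x : R) : 0 <= A w x.
Proof.
rewrite leNgt; apply/negP => Ax.
set d := - (el (- x) * A w x).
have d0 : 0 < d by rewrite oppr_gt0 pmulr_rlt0 ?expl_gt0.
pose y := Num.max x ((S * hintegral b + 1) / d / l).
have xy : x <= y by rewrite le_max lexx.
have h1 : A w y <= - d * el y.
  have := Adec xy; rewrite -[X in _ <= X](opprK) -/d => h.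
  rewrite -[leLHS]mul1r -(elNM y) -mulrA mulrC ler_pM2r ?expl_gt0//.
have h2 : - (S * hintegral b) <= A w y.
  have := bconv_bound kb (@lw y) (tw y) (fun z _ => hS z).
  by rewrite ler_norml => /andP[].
have h3 : 1 + l * y <= el y by exact: expR_ge1Dx.
have h4 : (S * hintegral b + 1) / d / l <= y by rewrite le_max lexx orbT.
have h5 : S * hintegral b + 1 <= d * (l * y).
  by move: h4; rewrite !ler_pdivrMr// => h4; rewrite (le_trans h4)// le_eqVlt;
    apply/orP; left; apply/eqP; ring.
have : d * (1 + l * y) <= d * el y by rewrite ler_pM2l.
lra.
Qed.

Lemma A_cvg0 : A w x @[x --> -oo] --> 0.
Proof.
apply/cvgrPdist_le => e e0.
have eK : 0 < e / hintegral b by rewrite divr_gt0.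
have [M hM] := nearNy_le ((@cvgrPdist_le _ _ _ _ _ _ _).1 wNy _ eK).
apply: (@le_nearNy _ _ M) => x xM; rewrite sub0r normrN.
rewrite -[e](@divfK _ (hintegral b)) ?gt_eqF//.
apply: (bconv_bound kb (@lw x) (tw x)) => z zx.
by have := hM z (le_trans (ltW zx) xM); rewrite sub0r normrN.
Qed.

(* Near [-oo] the records of [|w|] are attained with [w > 0], where they are
   controlled by [A w]. *)
Lemma w_le_A : exists C x1 : R, [/\ 0 < C, forall x, x <= x1 -> `|w x| <= 1,
  forall x, x <= x1 -> p (w x) <= l / 2 * A w x &
  forall x, x <= x1 -> `|w x| <= C * A w x].
Proof.
have [c1 [c2 [c3 [c10 c20 c30 [hr hrN _]]]]] := record_bound_abs kb.
pose C := c2 / c1; have Cp : 0 < C by rewrite divr_gt0.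
(* Two smallness conditions on [|w|]: under the first, [c3 * p (w x)] is too small to allow a record
   with [w < 0]; under the second, [|w x| <= C * A] implies [p (w x) <= l / 2 * A]. *)
pose eta := Num.min 1 (Num.min (c1 / (2 * c3 * C0)) (l / (2 * C * C0))).
have eta0 : 0 < eta.
  by rewrite lt_min ltr01/= lt_min; apply/andP; split; apply: divr_gt0 => //; apply: mulr_gt0 => //; apply: mulr_gt0.
have eta1 : eta <= 1 by rewrite ge_min lexx.
have eta2 : 2 * c3 * C0 * eta <= c1.
  by rewrite mulrC -ler_pdivlMr ?mulr_gt0// !ge_min lexx !orbT.
have eta3 : 2 * C * C0 * eta <= l.
  have h : 0 < 2 * C * C0 by apply: mulr_gt0 => //; apply: mulr_gt0.
  by rewrite mulrC -ler_pdivlMr// !ge_min lexx !orbT.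
have [x1 hx1] := nearNy_le ((@cvgrPdist_le _ _ _ _ _ _ _).1 wNy _ eta0).
have weta x : x <= x1 -> `|w x| <= eta by move=> /hx1; rewrite sub0r normrN.
have peta x : x <= x1 -> p (w x) <= C0 * eta * `|w x|.
  move=> xx; apply: le_trans (p2 (le_trans (weta x xx) eta1)) _.
  by rewrite -mulrA ler_pM2l// -real_normK ?num_real// expr2 ler_wpM2r// weta.
(* Here [|w x|] is bounded through the value of [A] at an earlier record point [x0]. The
   monotonicity of [A], proved below from this very bound, moves the estimate to [x]. *)
have recA x : x <= x1 -> exists x0, [/\ x0 <= x, `|w x| <= C * A w x0 &
    forall z, z <= x -> `|w z| <= C * A w x0].
  move=> xx.
  have [[y [yx wy0]]|nex] := pselect (exists y, y <= x /\ 0 < `|w y|); last first.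
    have w0 z : z <= x -> `|w z| <= C * A w x.
      move=> zx; have [->|wz] := eqVneq (w z) 0.
        by rewrite normr0 mulr_ge0 ?A_ge0 ?(ltW Cp).
      by exfalso; apply: nex; exists z; rewrite normr_gt0.
    by exists x; split => //; exact: w0.
  have wn0 : `|w z| @[z --> -oo] --> 0 by rewrite -(normr0 R); exact: cvg_norm.
  have [x0 [x0x wx0 hx0]] := attain_max (continuous_norm cw) wn0 yx wy0.
  have x01 : x0 <= x1 by exact: le_trans xx.
  have mx z : z <= x0 -> `|w z| <= `|w x0| by move=> zz; apply: hx0; exact: le_trans x0x.
  suff h : `|w x0| <= C * A w x0.
    by exists x0; split => // [|z zx]; apply: le_trans h; exact: hx0.
  have [wp|wn] := leP 0 (w x0).
    have hm z : z <= x0 -> `|w z| <= w x0 by move=> /mx; rewrite (ger0_norm wp).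
    have h := hr w x0 (@lw x0) (tw x0) hm; rewrite eqw in h.
    rewrite (ger0_norm wp) /C mulrAC ler_pdivlMr// mulrC (le_trans h)// gerDl oppr_le0.
    by rewrite mulr_ge0 ?p0 ?(ltW c30).
  have hm z : z <= x0 -> `|w z| <= - w x0 by move=> /mx; rewrite (ltr0_norm wn).
  have h := hrN w x0 (@lw x0) (tw x0) hm; rewrite eqw -(ltr0_norm wn) in h.
  exfalso; have h1 := peta x0 x01; have h2 := A_ge0 x0.
  have h3 : 0 <= c2 * A w x0 by rewrite mulr_ge0 ?(ltW c20).
  have h4 : c3 * p (w x0) <= c3 * (C0 * eta * `|w x0|) by rewrite ler_pM2l.
  have h5 : 2 * c3 * C0 * eta * `|w x0| <= c1 * `|w x0| by rewrite ler_pM2r.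
  have h6 : 0 < c1 * `|w x0| by rewrite mulr_gt0.
  lra.
have pA x y : x <= x1 -> (forall z, z <= x -> A w z <= A w y) -> p (w x) <= l / 2 * A w y.
  move=> xx hy; apply: le_trans (peta x xx) _.
  have [x0 [x0x h _]] := recA x xx.
  have h1 : `|w x| <= C * A w y.
    by apply: (le_trans h); rewrite ler_pM2l//; exact: hy.
  apply: (@le_trans _ _ (C0 * eta * (C * A w y))).
    by rewrite ler_pM2l ?mulr_gt0.
  rewrite (_ : _ * (C * _) = (2 * C * C0 * eta) / 2 * A w y); last by field.
  by rewrite ler_wpM2r ?A_ge0// ler_pM2r ?invr_gt0.
(* Otherwise [A w] has a positive maximum at some [y0 < y], where the differential equation gives
   [l * A = p (w y0)], against [p (w y0) <= l / 2 * A]. *)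
have Amono x y : x <= y -> y <= x1 -> A w x <= A w y.
  move=> xy yx1; rewrite leNgt; apply/negP => Ayx.
  have cA : continuous (A w) by move=> z; exact: der_cont (dA z).
  have Ax0 : 0 < A w x by exact: le_lt_trans (A_ge0 y) Ayx.
  have [y0 [y0y Ay0 hy0]] := attain_max cA A_cvg0 xy Ax0.
  have y0lt : y0 < y.
    rewrite lt_neqAle y0y andbT; apply/eqP => E.
    by have := hy0 x xy; rewrite E leNgt Ayx.
  have E : l * A w y0 - p (w y0) = 0.
    apply: (der_max (dA y0) y0lt) hy0 => z _.
    by exists (l * A w z - p (w z)); exact: dA.
  have := pA y0 y0 (le_trans y0y yx1) _.
  have h z : z <= y0 -> A w z <= A w y0 by move=> zz; apply: hy0; exact: le_trans y0y.
  move=> /(_ h) h1; have : 0 < l * A w y0 by rewrite mulr_gt0.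
  lra.
exists C, x1; split => //.
- by move=> x xx; exact: le_trans (weta x xx) eta1.
- by move=> x xx; apply: pA => // z zx; exact: Amono.
- move=> x xx; have [x0 [x0x h _]] := recA x xx.
  by apply: (le_trans h); rewrite ler_pM2l//; exact: Amono.
Qed.

(** A bootstrap. From [p (w x) <= l / 2 * A] follows [A' >= l / 2 * A], hence decay at half the
    rate. Then [p (w x)] is at most [C5 * e^(l x / 2) * A], a perturbation with integrable
    coefficient, and the last factor of [Q] is the integrating factor that restores the full
    rate. *)
Lemma left_exp_bound : exists C1 C2 x1 : R, [/\ 0 < C1, 0 < C2,
  forall x, x <= x1 -> `|w x| <= 1, forall x, x <= x1 -> A w x <= C1 * el x &
  forall x, x <= x1 -> `|w x| <= C2 * el x].
Proof.
have [C [x1 [Cp w1 pA wA]]] := w_le_A.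
pose eh (x : R) := expR (l / 2 * x).
have eh0 x : 0 < eh x by exact: expR_gt0.
have eh2 x : eh x * eh (- x) = 1 by rewrite /eh -expRD -mulrDr subrr mulr0 expR0.
have deh (x : R) : der eh x (l / 2 * eh x) by exact: der_expZ.
have dehN (x : R) : der (fun x => eh (- x)) x (- (l / 2) * eh (- x)).
  by refine (derE (der_comp (derN (der_id x)) (deh (- x))) _); ring.
pose C4 := eh (- x1) * A w x1 + 1.
have C40 : 0 < C4 by rewrite ltr_wpDl// mulr_ge0 ?A_ge0// ltW.
have A4 x : x <= x1 -> A w x <= C4 * eh x.
  move=> xx.
  have h : eh (- x) * A w x <= eh (- x1) * A w x1.
    have hle := @der_le _ (fun z => eh (- z) * A w z)
      (fun z => eh (- z) * (l / 2 * A w z - p (w z))) x x1 xx.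
    apply: hle => z.
      by move=> _; refine (derE (derM (dehN z) (dA z)) _); field.
    by move=> /andP[_ /ltW zx]; rewrite mulr_ge0 ?(ltW (eh0 _))// subr_ge0 pA.
  rewrite -[leLHS]mul1r -(eh2 x) -mulrA mulrC ler_pM2r//.
  by rewrite (le_trans h)// lerDl.
pose C5 := C0 * C ^+ 2 * C4.
have C50 : 0 < C5 by rewrite !mulr_gt0// exprn_gt0.
have p5 x : x <= x1 -> p (w x) <= C5 * eh x * A w x.
  move=> xx; apply: le_trans (p2 (w1 x xx)) _.
  have h1 := wA x xx; have h2 := A4 x xx.
  apply: (@le_trans _ _ (C0 * (C * A w x) ^+ 2)).
    by rewrite ler_pM2l// -real_normK ?num_real// lerXn2r ?nnegrE ?mulr_ge0 ?A_ge0 ?(ltW Cp).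
  rewrite (_ : C0 * _ = C0 * C ^+ 2 * A w x * A w x); last by ring.
  rewrite ler_wpM2r ?A_ge0// /C5 -[leRHS]mulrA ler_pM2l// mulr_gt0// exprn_gt0//.
pose Q x := el (- x) * A w x * expR (2 * C5 / l * eh x).
have lex x : el (- x) * A w x <= Q x.
  rewrite /Q ler_peMr ?mulr_ge0 ?A_ge0 ?(ltW (expl_gt0 _ _))//.
  by rewrite -expR0 ler_expR mulr_ge0 ?(ltW (eh0 _))// divr_ge0 ?(ltW l0)// mulr_ge0 ?(ltW C50).
have Qle x : x <= x1 -> Q x <= Q x1.
  move=> xx; have hle := @der_le _ Q (fun z => el (- z) * expR (2 * C5 / l * eh z) *
      (C5 * eh z * A w z - p (w z))) x x1 xx.
  apply: hle => z.
    move=> _.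
    have d1 := der_comp (derN (der_id z)) (expl_der l (- z)).
    have d2 := der_comp (derZ (2 * C5 / l) (deh z)) (is_derive_expR _).
    refine (derE (derM (derM d1 (dA z)) d2) _).
    by field; rewrite gt_eqF.
  move=> /andP[_ /ltW zx]; rewrite mulr_ge0 ?subr_ge0 ?p5//.
  by rewrite mulr_ge0 ?expR_ge0 ?(ltW (expl_gt0 _ _)).
pose C6 := Q x1 + 1.
have C60 : 0 < C6.
  rewrite ltr_wpDl// /Q !mulr_ge0 ?A_ge0 ?expR_ge0//.
have A6 x : x <= x1 -> A w x <= C6 * el x.
  move=> xx; rewrite -[leLHS]mul1r -(elNM x) -mulrA mulrC ler_pM2r ?expl_gt0//.
  by rewrite (le_trans (lex x))// (le_trans (Qle x xx))// lerDl.
exists C6, (C * C6), x1; split => //; first by rewrite mulr_gt0.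
by move=> x xx; rewrite (le_trans (wA x xx))// -mulrA ler_pM2l// A6.
Qed.

(* [m] is the limit at [-oo], that is the supremum, of [e^(-l x) A w x], up to
   the factor by which [A] multiplies [e^(l x)]. *)
Lemma left_asymptotics : exists m C x1 : R, [/\ 0 < m, 0 < C &
  forall x, x <= x1 -> `|w x - m * el x| <= C * el x ^+ 2].
Proof.
have [C1 [C2 [x1 [C10 C20 w1 A1 w2]]]] := left_exp_bound.
have [c1 [c2 [c3 [c10 c20 c30 [_ _ hr]]]]] := record_bound_abs kb.
have [k k0 Ak] := bconv_expl kb.
pose L x := el (- x) * A w x.
have AL x : A w x = el x * L x by rewrite /L mulrA elNM mul1r.
have Ldec x y : x <= y -> L y <= L x by exact: Adec.
have LC1 x : L x <= C1.
  have h y : y <= x1 -> L y <= C1.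
    move=> yx; rewrite -(ler_pM2l (expl_gt0 l y)) -AL mulrC mulrC [leRHS]mulrC.
    exact: A1.
  have [xx|/ltW xx] := leP x x1; first exact: h.
  by rewrite (le_trans (Ldec _ _ xx))// h.
pose m' := sup (range L).
have supL : has_sup (range L) by split; [exists (L 0), 0|exists C1 => _ [x _ <-]].
have Lm x : L x <= m' by apply: ub_le_sup; [case: supL|exists x].
pose C8 := C0 * C2 ^+ 2.
have C80 : 0 < C8 by rewrite mulr_gt0// exprn_gt0.
have p8 x : x <= x1 -> p (w x) <= C8 * el x ^+ 2.
  move=> xx; apply: le_trans (p2 (w1 x xx)) _.
  rewrite /C8 -mulrA ler_pM2l// -exprMn -real_normK ?num_real//.
  by rewrite lerXn2r ?nnegrE ?mulr_ge0 ?(ltW C20) ?(ltW (expl_gt0 _ _))// w2.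
(* The derivative of [L] is [- el (- x) * p (w x)], at least [- C8 * el x], so [L + C8 / l * el] is
   nondecreasing: the supremum is approached at the rate [el x]. *)
have mL x : x <= x1 -> m' <= L x + C8 / l * el x.
  move=> xx; have el0 : 0 <= C8 / l * el x.
    by rewrite mulr_ge0 ?(ltW (expl_gt0 _ _))// divr_ge0 ?(ltW C80) ?(ltW l0).
  apply: ge_sup; first by exists (L 0), 0.
  move=> _ [z _ <-]; have [xz|/ltW zx] := leP x z.
    by rewrite (le_trans (Ldec _ _ xz))// lerDl.
  have hle := @der_le _ (fun z => L z + C8 / l * el z)
    (fun z => el (- z) * (C8 * el z ^+ 2 - p (w z))) z x zx.
  apply: (@le_trans _ _ (L z + C8 / l * el z)).
    by rewrite lerDl mulr_ge0 ?(ltW (expl_gt0 _ _))// divr_ge0 ?(ltW C80) ?(ltW l0).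
  apply: hle => y.
    move=> _; have d1 := der_comp (derN (der_id y)) (expl_der l (- y)).
    refine (derE (derD (derM d1 (dA y)) (derZ _ (expl_der l y))) _).
    rewrite (_ : el (- y) * (C8 * el y ^+ 2 - p (w y)) =
      C8 * (el y * el (- y)) * el y - el (- y) * p (w y)); last by ring.
    by rewrite elNM; field; rewrite gt_eqF.
  move=> /andP[_ /ltW yx]; rewrite mulr_ge0 ?(ltW (expl_gt0 _ _))// subr_ge0 p8//.
  exact: le_trans xx.
(* If [m' <= 0], then [A w] vanishes identically, hence so does [p (w x)] by the differential
   equation, against its limit [p Wp > 0] at [+oo]. *)
have m'0 : 0 < m'.
  rewrite ltNge; apply/negP => m0.
  have A00 x : A w x = 0.
    apply/eqP; rewrite eq_le A_ge0 andbT AL pmulr_rle0 ?expl_gt0//.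
    exact: le_trans (Lm x) m0.
  have pw0 x : p (w x) = 0.
    have E : A w = cst 0 by apply/funext => y; exact: A00.
    have := dA x; rewrite E mulr0 sub0r => -[_ h].
    by apply/eqP; rewrite -oppr_eq0 -h derive_cst.
  have h : p (w x) @[x --> +oo] --> p Wp by exact: (cvg_comp _ _ wy pc).
  have [N hN] := neary_ge (cvgr_gt _ h _ pW).
  by have := hN N (lexx N); rewrite pw0 ltxx.
pose m : R := m' / k; have m0 : 0 < m by rewrite divr_gt0.
pose v x := w x - m * el x.
have cel : continuous el by exact: expl_cont.
have lel x : lcont el x by move=> y _; exact: cel.
have cv : continuous v.
  move=> x; have h1 := contZ m (cel x).
  have h2 := contB (@cw x) h1.
  exact: h2.
have lv x : lcont v x by move=> y _; exact: cv.
have tel x : tame el x by exact: (expl_tame kb).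
have tv x : tame v x by apply: tame_lin; [exact: tw|exact: tel].
have a0 : 0 < a by case: kb => -[].
have a1 : a < 1 by case: kb => -[].
(* Subtracting a solution of the linear equation leaves the residual [p (w x)] unchanged, and this
   is quadratic in [el x]; the choice of [m] makes [A v] quadratic as well. *)
have Dv x : kap * v x - D v x = p (w x).
  rewrite (J_linr a0 a1 m (adm_nuk a0) (@lw x) (@lel x) (tw x) (tel x)) (D_expl kb) -eqw.
  by rewrite /v; ring.
have Av x : A v x = el x * (L x - m').
  rewrite /bconv (J_linr a0 a1 m (adm_b kb) (@lw x) (@lel x) (tw x) (tel x)).
  rewrite (_ : _ - _ = A w x - m * A el x); last by rewrite /bconv /v; ring.
  by rewrite Ak AL /m; field; rewrite gt_eqF.
pose C := (c2 * (C8 / l) + c3 * C8) / c1.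
have C00' : 0 < C.
  apply: divr_gt0 => //; apply: addr_gt0; apply: mulr_gt0 => //.
  exact: divr_gt0.
have key x : x <= x1 -> (forall z, z <= x -> `|v z| <= `|v x|) -> `|v x| <= C * el x ^+ 2.
  move=> xx hv; have := hr v x (@lv x) (tv x) hv; rewrite Dv (ger0_norm (p0 _)) => h.
  have Avx : `|A v x| <= C8 / l * el x ^+ 2.
    rewrite Av normrM (ger0_norm (ltW (expl_gt0 _ _))) expr2 mulrCA ler_pM2l ?expl_gt0//.
    rewrite ler_norml; apply/andP; split.
      by have := mL x xx; rewrite lerNl opprB lerBlDl.
    rewrite (@le_trans _ _ 0)//; first by rewrite subr_le0 Lm.
    by rewrite mulr_ge0 ?(ltW (expl_gt0 _ _))// divr_ge0 ?(ltW C80) ?(ltW l0).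
  rewrite /C mulrAC ler_pdivlMr// mulrC (le_trans h)// mulrDl.
  by apply: lerD; rewrite -mulrA ler_pM2l// p8.
(* [key] holds at records of [|v|] only; elsewhere the bound is taken from an earlier record, since
   [el] increases. *)
exists m, C, x1; split => // x xx; rewrite -/(v x).
have [[y [yx vy0]]|nex] := pselect (exists y, y <= x /\ 0 < `|v y|); last first.
  have [->|vx] := eqVneq (v x) 0.
    by rewrite normr0 mulr_ge0 ?exprn_ge0 ?(ltW C00') ?(ltW (expl_gt0 _ _)).
  by exfalso; apply: nex; exists x; rewrite normr_gt0.
have vn0 : `|v z| @[z --> -oo] --> 0.
  rewrite -(normr0 R); apply: cvg_norm; rewrite -[X in _ --> X](subr0 0).
  apply: cvgB => //; rewrite -(mulr0 m); apply: cvgMl_tmp; exact: expRM_cvgNy.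
have [x0 [x0x vx0 hx0]] := attain_max (continuous_norm cv) vn0 yx vy0.
apply: (le_trans (hx0 x (lexx x))).
apply: (@le_trans _ _ (C * el x0 ^+ 2)).
  apply: key; first exact: le_trans xx.
  by move=> z zz; apply: hx0; exact: le_trans x0x.
rewrite ler_pM2l// lerXn2r ?nnegrE ?(ltW (expl_gt0 _ _))//.
exact: (expl_le kb).
Qed.

End left_asymptotics.

(** * Comparison and barriers *)

Section comparison.
Context {R : realType}.
Variable a : R.
Hypotheses (a0 : 0 < a) (a1 : a < 1).
Notation D := (J (nuk a)).

Lemma first_zero (d : R -> R) (M y : R) : continuous d ->
  (forall x, x <= M -> 0 < d x) -> d y <= 0 ->
  exists2 x0, d x0 = 0 & forall z, z < x0 -> 0 < d z.
Proof.
move=> cd hM hy; pose Z := [set x | d x <= 0].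
have lbM : lbound Z M.
  by move=> x Zx; rewrite leNgt; apply/negP => /ltW /hM; rewrite ltNge Zx.
have infZ : has_inf Z by split; [exists y|exists M].
pose x0 := inf Z.
have left z : z < x0 -> 0 < d z.
  move=> zx; rewrite ltNge; apply/negP => dz.
  by have := ge_inf infZ.2 dz; rewrite leNgt zx.
exists x0 => //; apply/eqP; rewrite eq_le; apply/andP; split.
  rewrite leNgt; apply/negP => dx0.
  have [e /= e0 he] := cvgr_gt _ (cd x0) _ dx0.
  have [z Zz zx] := inf_adherent e0 infZ.
  have x0z := ge_inf infZ.2 Zz; rewrite -/x0 in x0z.
  have : 0 < d z by apply: he; rewrite /= distrC ger0_norm ?subr_ge0// ltrBlDl.
  by rewrite ltNge Zz.
rewrite leNgt; apply/negP => dx0.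
have [e /= e0 he] := cvgr_lt _ (cd x0) _ dx0.
have e2 : 0 < e / 2 by rewrite divr_gt0.
have : d (x0 - e / 2) < 0.
  by apply: he; rewrite /= subKr gtr0_norm// ltr_pdivrMr// ltr_pMr// ltr1n.
have : 0 < d (x0 - e / 2) by apply: left; rewrite ltrBlDr ltrDl.
by move=> /lt_trans h /h; rewrite ltxx.
Qed.

(* At a first zero [x0] of [d] all differences [d x0 - d (x0 - t)] are negative,
   so that [D d x0 < 0]. *)
Lemma comparison (d : R -> R) (M : R) : continuous d -> (forall x, tame d x) ->
  (forall x, x <= M -> 0 < d x) -> (forall x, d x = 0 -> D d x = 0) ->
  forall x, 0 < d x.
Proof.
move=> cd td hM hD x; rewrite ltNge; apply/negP => dx.
have [x0 dx0 hx0] := first_zero cd hM dx.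
have ld : lcont d x0 by move=> y _; exact: cd.
have ok := hintegrableJ a0 a1 (adm_nuk a0) ld (td x0).
have e (t : R) : 0 < t -> -1 * (nuk a t * (d x0 - d (x0 - t))) = nuk a t * d (x0 - t).
  by move=> _; rewrite dx0; ring.
have ok' := eq_hintegrable e (hintegrableZ (-1) ok).
have : 0 < hintegral (fun t => nuk a t * d (x0 - t)).
  apply: hintegral_gt0 => //.
    move=> t t0; apply: contM; first exact: pcont_nuk.
    by apply: cont_shift; exact: cd.
  by move=> t t0; rewrite mulr_gt0 ?nuk_gt0// hx0// ltrBlDr ltrDl.
by rewrite -(eq_hintegral e) (hintegralZ (-1) ok) -/(J (nuk a) d x0) hD// mulr0 ltxx.
Qed.

(* As [1 <= 2 t / (t + r)] for [r < t] and [t / r <= 2 t / (t + r)] for [t <= r],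
   the constant comes from [hintegrable_dom]. *)
Definition cD : R := 2 * a * domC a.

Lemma cD_gt0 : 0 < cD.
Proof. by rewrite !mulr_gt0// addr_gt0 ?invr_gt0// subr_gt0. Qed.

Lemma D_upper (v : R -> R) (x r S : R) : lcont v x -> tame v x -> 0 < r -> 0 <= S ->
  (forall t, 0 < t -> v x - v (x - t) <= S * (t / r)) ->
  (forall t, r < t -> v x - v (x - t) <= S) ->
  D v x <= cD * S * pk a r.
Proof.
move=> cv tv r0 S0 h1 h2.
have [okd intd] := hintegrable_hintegral_dom a0 a1 r0.
have ok := hintegrableJ a0 a1 (adm_nuk a0) cv tv.
apply: (@le_trans _ _ (2 * a * S * hintegral (fun t => pk a t / (t + r)))); last first.
  rewrite (_ : cD * S * pk a r = 2 * a * S * (domC a * pk a r)); last by rewrite /cD; ring.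
  by rewrite ler_wpM2l ?mulr_ge0 ?(ltW a0).
rewrite -(hintegralZ _ okd); apply: hintegral_le => //; first exact: hintegrableZ.
move=> t t0; have tr : 0 < t + r by rewrite addr_gt0.
rewrite (_ : 2 * a * S * _ = nuk a t * (S * (2 * t / (t + r)))); last first.
  by rewrite /nuk; field; rewrite !gt_eqF.
rewrite ler_pM2l ?nuk_gt0//.
have [rt|tr'] := ltP r t.
  apply: (le_trans (h2 t rt)); rewrite ler_peMr// ler_pdivlMr// mul1r; lra.
apply: (le_trans (h1 t t0)); rewrite ler_wpM2l// ler_pdivrMr// mulrAC ler_pdivlMr//.
rewrite -mulrA mulrCA ler_pM2l//; lra.
Qed.

Lemma ramp (w : R -> R) (Wp g x y : R) : continuous w -> (forall z, tame w z) ->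
  0 < Wp -> (forall z, 0 <= w z <= Wp) -> x < y ->
  (forall z, x <= z -> z <= y -> g <= D w z) ->
  g <= cD * (2 * Wp) * pk a (y - x).
Proof.
move=> cw tw W0 hw xy hg; set Y := y - x.
have Y0 : 0 < Y by rewrite subr_gt0.
pose u z := w z - 2 * Wp / Y * (z - x).
have cu : continuous u.
  move=> z; apply: (contB (cw z)); apply: contZ; apply: contB; first exact: cont_id.
  exact: cont_cst.
have [|x0 + hx0] := @EVT_min R u x y (ltW xy); first exact: continuous_subspaceT.
rewrite in_itv/= => /andP[xx0 x0y].
have uy : u y = w y - 2 * Wp by rewrite /u -/Y; field; rewrite gt_eqF.
(* The value at [y] forces this. It means that the line has risen above [w x0], which gives the
   increment bound also for [x0 - t < x], where the minimality of [u] on the segment says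
   nothing. *)
have ux0 : u x0 <= - Wp.
  have := hx0 y; rewrite in_itv/= lexx (ltW xy) => /(_ isT); rewrite uy => h.
  by have /andP[_ h2] := hw y; lra.
have C0 : 0 <= 2 * Wp / Y by rewrite divr_ge0 ?mulr_ge0 ?(ltW W0) ?(ltW Y0).
apply: (le_trans (hg x0 xx0 x0y)); apply: D_upper => //.
- by move=> z _; exact: cw.
- by rewrite mulr_ge0// ltW.
- move=> t t0; rewrite (_ : 2 * Wp * (t / Y) = 2 * Wp / Y * t); last by ring.
  have [xt|tx] := leP x (x0 - t).
    have := hx0 (x0 - t); rewrite in_itv/= xt (_ : x0 - t <= y) => [/(_ isT)|].
      rewrite /u; set c := 2 * Wp / Y => h.
      have : c * (x0 - t - x) = c * (x0 - x) - c * t by ring.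
      lra.
    lra.
  have h1 : 2 * Wp / Y * (x0 - x) <= 2 * Wp / Y * t by rewrite ler_wpM2l//; lra.
  have /andP[h2 _] := hw (x0 - t).
  move: ux0 h1; rewrite /u; lra.
- move=> t _; have /andP[h2 _] := hw (x0 - t); have /andP[_ h3] := hw x0; lra.
Qed.

Lemma pk_mono (s t : R) : 0 < s -> s <= t -> pk a t <= pk a s.
Proof.
move=> s0 st; apply: (@der_ge _ (pk a) (fun t => - (a * (pk a t / t)))) => // z /andP[sz _].
  by apply: der_pk; exact: lt_le_trans sz.
have z0 : 0 < z by exact: lt_trans sz.
by rewrite oppr_le0 mulr_ge0 ?(ltW a0)// divr_ge0 ?(ltW (pk_gt0 _ _)) ?(ltW z0).
Qed.

Lemma pk_half (t : R) : 0 < t -> pk a (t / 2) <= 2 * pk a t.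
Proof.
move=> t0; rewrite pkM ?invr_ge0 ?(ltW t0)// mulrC ler_pM2r ?pk_gt0//.
have h : pk a 2^-1 * 2^-1 <= 1 by apply: pk_le_pow => //; rewrite ?invr_gt0// invf_le1// ler1n.
by rewrite -[2 in leRHS]mul1r -ler_pdivrMr.
Qed.

Lemma right_tail (w : R -> R) (Wp rho X : R) : continuous w -> (forall z, tame w z) ->
  0 < Wp -> 0 < rho -> (forall z, 0 <= w z <= Wp) -> w z @[z --> +oo] --> Wp ->
  (forall x, X <= x -> rho * (Wp - w x) <= D w x) ->
  exists r, forall x, r <= x ->
    Wp - w x <= 4 * cD * Wp / rho * pk a (x - X).
Proof.
move=> cw tw W0 r0 hw wy hD.
have cD0 := cD_gt0.
(* [q] makes the two bounds collide exactly: at the maximum [rho * zeta] equals the upper bound for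
   [D w], where [4] is the [2] of the height [2 * Wp] in [D_upper] times the [2] of [pk_half]. The
   radius [r] solves [r^(- a) = q], so that [zeta] is [Wp] up to [X + r]. *)
pose q := rho / (4 * cD); have q0 : 0 < q by apply: divr_gt0 => //; apply: mulr_gt0.
pose r := q `^ (- a^-1); have r'0 : 0 < r by exact: powR_gt0.
have pr : pk a r = q.
  by rewrite /pk -powRrM mulNr mulrN opprK mulVf ?gt_eqF// powRr1// ltW.
pose zeta x := Wp / q * pk a (Num.max (x - X) r).
have maxr x : 0 < Num.max (x - X) r by rewrite lt_max r'0 orbT.
have czeta : continuous zeta.
  move=> x.
  have h : {for x, continuous (fun x => pk a (Num.max (x - X) r))}.
    apply: (cont_comp (pk a) (fun x => Num.max (x - X) r)); last exact: pcont_pk.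
    apply: continuous_max; last exact: cont_cst.
    by apply: contB; [exact: cont_id|exact: cont_cst].
  by have := contZ (Wp / q) h; exact.
pose f x := Wp - w x - zeta x.
have cf : continuous f.
  by move=> x; apply: contB (czeta x); apply: contB (cw x); exact: cont_cst.
have fX x : x <= X + r -> f x <= 0.
  move=> xX; have -> : f x = - w x.
    rewrite /f /zeta (max_idPr _) ?lerBlDl// pr divfK ?gt_eqF//; ring.
  by rewrite oppr_le0; have /andP[] := hw x.
have fle x : f x <= 0.
  rewrite leNgt; apply/negP => fx.
  have xX : X + r < x by rewrite ltNge; apply/negP => /fX; rewrite leNgt fx.
  have fy : f x @[x --> +oo] --> 0.
    have zy : zeta x @[x --> +oo] --> 0.
      rewrite -[X in _ --> X](mulr0 (Wp / q)); apply: cvgMl_tmp.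
      apply: (cvg_comp _ _ _ (pk_cvgy a0)).
      apply/cvgryPge => A; near=> t; rewrite le_max; apply/orP; left.
      by rewrite lerBrDr; near: t; apply: nbhs_pinfty_ge; rewrite num_real.
    rewrite -[X in _ --> X](subr0 0); apply: cvgB zy.
    by rewrite -[X in _ --> X](subrr Wp); apply: cvgB wy; exact: cvg_cst.
  (* [f] is nonpositive up to [X + r] and tends to [0] at [+oo], so a positive value yields a global
     maximum; the reflection fits it to [attain_max]. *)
  have cfN : continuous (fun z => f (0 - z)).
    by move=> z; apply: cont_shift; exact: cf.
  have fN : f (0 - z) @[z --> -oo] --> 0.
    apply: (cvg_comp _ _ _ fy); apply/cvgNrNy.
    rewrite (_ : - (fun z : R => 0 - z) = id); first exact: cvg_id.
    by apply/funext => z; rewrite /GRing.opp/= sub0r opprK.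
  have h1 : - x <= - (X + r) by rewrite lerN2 ltW.
  have h2 : 0 < f (0 - - x) by rewrite sub0r opprK.
  have [y0 [_ fy0 hy0]] := attain_max cfN fN h1 h2.
  set x0 := 0 - y0 in fy0 hy0.
  have hx0 z : f z <= f x0.
    have [zX|/ltW zX] := leP z (X + r).
      by rewrite (le_trans (fX z zX))// ltW.
    by have := hy0 (- z); rewrite sub0r opprK; apply; rewrite lerN2.
  have x0X : X + r < x0 by rewrite ltNge; apply/negP => /fX; rewrite leNgt fy0.
  set y1 := x0 - X.
  have ry1 : r < y1 by rewrite ltrBrDl.
  have y10 : 0 < y1 by exact: lt_trans ry1.
  have y20 : 0 < y1 / 2 by rewrite divr_gt0.
  have zx0 : zeta x0 = Wp / q * pk a y1 by rewrite /zeta (max_idPl _)// ltW.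
  (* At the maximum of [f] the increments of [w] are at most those of [zeta]. Within distance
     [y1 / 2] of [x0] the latter have slope at most [Wp / (y1 / 2)], by the mean value theorem and
     [pk a z <= q] beyond [r]. *)
  have key (t : R) : 0 < t -> t <= y1 / 2 -> w x0 - w (x0 - t) <= 2 * Wp * (t / (y1 / 2)).
    move=> t0 ty.
    have h3 : w x0 - w (x0 - t) <= zeta (x0 - t) - zeta x0.
      by have := hx0 (x0 - t); rewrite /f; lra.
    apply: (le_trans h3); rewrite zx0 /zeta -mulrBr.
    set s := Num.max _ r.
    have s1 : s <= y1.
      by rewrite ge_max (ltW ry1) andbT /y1 lerB// lerBlDr lerDl ltW.
    have rs : r <= s by rewrite le_max lexx orbT.
    have s2 : y1 - t <= s by rewrite le_max /y1 addrAC lexx.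
    have s3 : y1 / 2 <= s by lra.
    move: s1; rewrite le_eqVlt => /predU1P[->|s1].
      by rewrite subrr mulr0 !mulr_ge0 ?invr_ge0 ?mulr_ge0 ?(ltW W0) ?(ltW t0) ?(ltW y10).
    have [z|z /andP[sz zy] E] := @der_MVT _ (pk a) (fun t => - (a * (pk a t / t))) s y1 s1.
      by move=> /andP[sz _]; apply: der_pk; exact: lt_le_trans (lt_le_trans r'0 rs) sz.
    have -> : pk a s - pk a y1 = a * (pk a z / z) * (y1 - s) by rewrite -[LHS]opprB E; ring.
    have z0 : 0 < z by exact: lt_trans (lt_le_trans r'0 rs) sz.
    have e1 : pk a z <= q by rewrite -pr; apply: pk_mono => //; exact: ltW (le_lt_trans rs sz).
    have e2 : (z)^-1 <= (y1 / 2)^-1 by rewrite lef_pV2 ?posrE// (le_trans s3)// ltW.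
    have e3 : a * (pk a z / z) <= 1 * (q * (y1 / 2)^-1).
      apply: ler_pM; rewrite ?(ltW a0) ?(ltW a1) ?divr_ge0 ?(ltW (pk_gt0 _ _)) ?(ltW z0)//.
      by apply: ler_pM => //; rewrite ?invr_ge0 ?(ltW (pk_gt0 _ _)) ?(ltW z0).
    have e4 : a * (pk a z / z) * (y1 - s) <= 1 * (q * (y1 / 2)^-1) * t.
      apply: ler_pM => //; rewrite ?subr_ge0 ?(ltW s1)//; last lra.
      by rewrite mulr_ge0 ?(ltW a0)// divr_ge0 ?(ltW (pk_gt0 _ _)) ?(ltW z0).
    apply: (@le_trans _ _ (Wp / q * (1 * (q * (y1 / 2)^-1) * t))).
      by rewrite ler_wpM2l// (divr_ge0 (ltW W0) (ltW q0)).
    rewrite (_ : Wp / q * _ = Wp * (t / (y1 / 2))); last by field; rewrite !gt_eqF.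
    by rewrite ler_wpM2r ?divr_ge0 ?(ltW t0) ?(ltW y10)//; lra.
  have up : D w x0 <= cD * (2 * Wp) * pk a (y1 / 2).
    apply: D_upper => //.
    - by move=> z _; exact: cw.
    - by rewrite mulr_ge0// ltW.
    - move=> t t0; have [ty|yt] := leP t (y1 / 2); first exact: key.
      have t1 : 1 <= t / (y1 / 2) by rewrite ler_pdivlMr// mul1r ltW.
      apply: (@le_trans _ _ (2 * Wp)); last by rewrite ler_peMr// mulr_ge0// ltW.
      have /andP[h3 _] := hw (x0 - t); have /andP[_ h4] := hw x0; lra.
    - move=> t _; have /andP[h3 _] := hw (x0 - t); have /andP[_ h4] := hw x0; lra.
  have lo : rho * (Wp - w x0) <= D w x0.
    by apply: hD; apply: ltW; apply: lt_trans x0X; rewrite ltrDl.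
  have h3 : zeta x0 < Wp - w x0 by rewrite -subr_gt0.
  have h4 : rho * zeta x0 < rho * (Wp - w x0) by rewrite ltr_pM2l.
  have h5 : cD * (2 * Wp) * pk a (y1 / 2) <= cD * (2 * Wp) * (2 * pk a y1).
    have h2W : 0 <= 2 * Wp by rewrite mulr_ge0// ltW.
    by rewrite ler_wpM2l ?pk_half// (mulr_ge0 (ltW cD0) h2W).
  have h6 : rho * zeta x0 = cD * (2 * Wp) * (2 * pk a y1).
    by rewrite zx0 /q; field; rewrite !gt_eqF.
  lra.
exists (X + r) => x xr; have := fle x; rewrite subr_le0 => h.
apply: (le_trans h); rewrite /zeta (max_idPl _) ?lerBrDl//.
rewrite le_eqVlt; apply/orP; left; apply/eqP; rewrite /q; field.
by rewrite !gt_eqF.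
Unshelve. all: by end_near. Qed.

End comparison.

(** * The profiles *)

Section wave_function.
Context {R : realType}.
Variables (f : R -> R) (c phim phip : R).
Hypotheses (fs : smooth f) (fc : @convex_function R R^o setT f).
Hypotheses (pp : phip < phim) (cE : c = (f phip - f phim) / (phip - phim)).
Notation h := (wave_h f c phim).
Notation dh := (derive1 h).

Lemma wave_h_phim : h phim = 0.
Proof. by rewrite /wave_h; ring. Qed.

Lemma wave_h_phip : h phip = 0.
Proof. by rewrite /wave_h cE; field; rewrite lt_eqF// subr_lt0. Qed.

Lemma wave_h_convex (x y s : R) : 0 <= s -> s <= 1 -> h (x + s * (y - x)) <= h x + s * (h y - h x).
Proof.
move=> s0 s1; have := @fc (Itv01 s0 s1) y x; rewrite !in_setT => /(_ isT isT).
have E (u v : R) : conv (Itv01 s0 s1) (u : R^o) v = s * u + (1 - s) * v by exact: convRE.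
rewrite (E (f y)).
have -> : @conv R (convex_lmodType R^o) (Itv01 s0 s1) y x = x + s * (y - x).
  by transitivity (s * y + (1 - s) * x); [exact: E | ring].
move=> H; rewrite /wave_h.
have -> : - c * (x - phim) + f x - f phim + s * (- c * (y - phim) + f y - f phim -
  (- c * (x - phim) + f x - f phim)) = - c * (x + s * (y - x) - phim) +
  (s * f y + (1 - s) * f x) - f phim by ring.
by rewrite lerD2r lerD2l.
Qed.

Lemma wave_h_le_max (u1 u2 z : R) : u1 <= z -> z <= u2 -> h z <= Num.max (h u1) (h u2).
Proof.
move=> h1 h2; have [u12|] := ltP u1 u2; last first.
  by move=> h3; rewrite le_max (_ : z = u1) ?lexx//; apply/eqP; rewrite eq_le h1 (le_trans h2).
have u0 : 0 < u2 - u1 by rewrite subr_gt0.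
pose s := (z - u1) / (u2 - u1).
have s0 : 0 <= s by rewrite divr_ge0 ?(ltW u0)// subr_ge0.
have s1 : s <= 1 by rewrite ler_pdivrMr// mul1r lerB.
have := wave_h_convex u1 u2 s0 s1; rewrite /s divfK ?gt_eqF// -/s addrC subrK => /le_trans; apply.
set M := Num.max _ _.
have m1 : h u1 <= M by rewrite le_max lexx.
have m2 : h u2 <= M by rewrite le_max lexx orbT.
rewrite (_ : h u1 + _ = (1 - s) * h u1 + s * h u2); last by ring.
rewrite [leRHS](_ : M = (1 - s) * M + s * M); last by ring.
by rewrite lerD// ler_wpM2l// subr_ge0.
Qed.

Lemma der_wave_h_explicit (u : R) : der h u (- c + derive1 f u).
Proof.
have := derB (derD (derZ (- c) (derB (der_id u) (der_cst phim u)))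
  (derivable_der (@fs 0%N u))) (der_cst (f phim) u).
by rewrite !subr0 mulr1.
Qed.

Lemma der_wave_h (u : R) : der h u (dh u).
Proof. by rewrite (der_derive1 (der_wave_h_explicit u)); exact: der_wave_h_explicit. Qed.

Lemma continuous_wave_h : continuous h.
Proof. by move=> u; exact: der_cont (der_wave_h u). Qed.

Lemma der_derive1_wave_h (u : R) : der dh u (derive1n 2 f u).
Proof.
have E : dh = fun u => - c + derive1 f u.
  by apply/funext => v; exact: der_derive1 (der_wave_h_explicit v).
have := derD (der_cst (- c) u) (derivable_der (@fs 1%N u)); rewrite add0r E; exact.
Qed.

Lemma continuous_derive1_wave_h : continuous dh.
Proof. by move=> u; exact: der_cont (der_derive1_wave_h u). Qed.

Lemma wave_h_tangent (x y : R) : h x + dh x * (y - x) <= h y.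
Proof.
have [->|xy] := eqVneq y x; first by rewrite subrr mulr0 addr0.
have yx : y - x != 0 by rewrite subr_eq0.
pose u n := harmonic n * (y - x).
have u0 : u n @[n --> \oo] --> 0.
  by rewrite -[X in _ --> X](mul0r (y - x)); apply: cvgMr_tmp; exact: cvg_harmonic.
have un n : u n != 0 by rewrite mulf_neq0// invr_neq0.
have hl : (h (x + u n) - h x) / u n * (y - x) @[n --> \oo] --> dh x * (y - x).
  by apply: cvgMr_tmp; exact: der_seq (der_wave_h x) un u0.
rewrite -lerBrDl; apply: (cvgr_to_le hl); near=> n.
have s0 : 0 < harmonic n :> R by exact: harmonic_gt0.
have s1 : harmonic n <= 1 :> R by rewrite /harmonic/= invf_le1// ler1n.
have := wave_h_convex x y (ltW s0) s1; rewrite -/(u n) -lerBlDl mulrC -ler_pdivrMr// => H.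
rewrite (_ : _ * (y - x) = (h (x + u n) - h x) / harmonic n)//.
by rewrite /u; field; rewrite yx gt_eqF.
Unshelve. all: by end_near. Qed.

(** The mean value bound is applied twice, with a bound for the second derivative of [f] within
    distance [1] of [phim]; adding [1] to it makes the constant positive. *)
Lemma wave_h_quadratic : exists2 S, 0 < S & forall u, `|u| <= 1 ->
  h (phim - u) + dh phim * u <= S * u ^+ 2.
Proof.
have cf2 : continuous (derive1n 2 f).
  by move=> u; exact: der_cont (derivable_der (@fs 2%N u)).
have [|S hS] := @bounded_segment _ _ (phim - 1) (phim + 1) _ cf2; first lra.
have S0 : 0 <= S by apply: le_trans (normr_ge0 _) (hS phim _ _); lra.
exists (S + 1) => [|u]; first lra.
rewrite ler_norml => /andP[u1 u2].
have inn z : Num.min (phim - u) phim <= z <= Num.max (phim - u) phim ->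
    phim - 1 <= z <= phim + 1 /\ `|z - phim| <= `|u|.
  rewrite ge_min le_max => /andP[zl zr].
  have [u0|u0] := leP 0 u.
    have z1 : phim - u <= z by case/orP: zl; lra.
    have z2 : z <= phim by case/orP: zr; lra.
    split; first by apply/andP; split; lra.
    by rewrite (ger0_norm u0) ler_norml; apply/andP; split; lra.
  have z1 : phim <= z by case/orP: zl; lra.
  have z2 : z <= phim - u by case/orP: zr; lra.
  split; first by apply/andP; split; lra.
  by rewrite (ltr0_norm u0) ler_norml; apply/andP; split; lra.
pose r z := h z - dh phim * (z - phim).
have dr (z : R) : der r z (dh z - dh phim).
  have := derB (der_wave_h z) (derZ (dh phim) (derB (der_id z) (der_cst phim z))).
  by rewrite subr0 mulr1.
have b1 (z : R) : Num.min (phim - u) phim <= z <= Num.max (phim - u) phim ->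
    `|dh z - dh phim| <= S * `|u|.
  move=> /inn[/andP[z1 z2] zu].
  apply: (@le_trans _ _ (S * `|z - phim|)); last by rewrite ler_wpM2l.
  apply: (@der_bound _ dh (derive1n 2 f)) => t; first by move=> _; exact: der_derive1_wave_h.
  rewrite ge_min le_max => /andP[tl tr]; apply: hS.
    by case/orP: tl; lra.
  by case/orP: tr; lra.
have := @der_bound _ r (fun z => dh z - dh phim) (S * `|u|) (phim - u) phim
  (fun z _ => dr z) b1.
rewrite (_ : phim - u - phim = - u); last by ring.
rewrite normrN -mulrA -expr2 real_normK ?num_real//.
rewrite /r wave_h_phim subrr mulr0 !subr0 ler_norml => /andP[_ H].
have u20 : 0 <= u ^+ 2 by exact: sqr_ge0.
have -> : dh phim * u = - (dh phim * (phim - u - phim)) by ring.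
apply: (le_trans H); rewrite ler_wpM2r//; lra.
Qed.

(** The positive slope at [phim] makes [h] negative at some [v] between [u] and [phim]; as [u] lies
    between [v] and the zero [phip], convexity concludes. *)
Lemma wave_h_lt0 (u : R) : 0 < dh phim -> phip < u -> u < phim -> h u < 0.
Proof.
move=> dm u1 u2; have [e /= e0 he] := cvgr_gt _ (@continuous_derive1_wave_h phim) _ dm.
pose t := Num.min (e / 2) ((phim - u) / 2); pose v := phim - t.
have t0 : 0 < t by rewrite lt_min !divr_gt0// subr_gt0.
have te : t < e by rewrite gt_min; apply/orP; left; lra.
have tu : t < phim - u by rewrite gt_min; apply/orP; right; lra.
have dv : 0 < dh v by apply: he; rewrite /= subKr gtr0_norm.
have hv : h v < 0.
  have := wave_h_tangent v phim; rewrite wave_h_phim /v subKr => H.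
  have : 0 < dh (phim - t) * t by rewrite mulr_gt0.
  lra.
have vp : 0 < v - phip by rewrite /v; lra.
pose s := (u - phip) / (v - phip).
have s0 : 0 < s by rewrite divr_gt0// subr_gt0.
have s1 : s <= 1 by rewrite ler_pdivrMr// mul1r lerB// /v; lra.
have := wave_h_convex phip v (ltW s0) s1.
rewrite /s divfK ?gt_eqF// -/s addrC subrK wave_h_phip add0r subr0 => /le_lt_trans; apply.
by rewrite pmulr_rlt0.
Qed.

(** The tangent at [v], evaluated at the zero [phip] of [h], gives [h v <= dh v * (v - phip)]; by
    continuity the slope keeps half of its size near [phip]. *)
Lemma wave_h_le_right : dh phip < 0 -> exists2 d, 0 < d & forall v, phip <= v -> v <= phip + d ->
  h v <= dh phip / 2 * (v - phip).
Proof.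
move=> dp; have dp2 : dh phip < dh phip / 2 by lra.
have [e /= e0 he] := cvgr_lt _ (@continuous_derive1_wave_h phip) _ dp2.
exists (e / 2); first by rewrite divr_gt0.
move=> v v1 v2.
have dv : dh v < dh phip / 2 by apply: he; rewrite /= distrC ger0_norm; lra.
have := wave_h_tangent v phip; rewrite wave_h_phip => H.
have : dh v * (v - phip) <= dh phip / 2 * (v - phip).
  by rewrite ler_wpM2r ?(ltW dv)// subr_ge0.
lra.
Qed.

End wave_function.

(** * A single profile *)

Section profile.
Context {R : realType}.
Variables (a : R) (f : R -> R) (c phim phip eps : R) (phi : R -> R).
Hypotheses (a0 : 0 < a) (a1 : a < 1).
Hypotheses (fs : smooth f) (fc : @convex_function R R^o setT f).
Hypotheses (pp : phip < phim) (cE : c = (f phip - f phim) / (phip - phim)).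
Notation h := (wave_h f c phim).
Notation dh := (derive1 h).
Notation G := (Gamma (1 - a)).
Notation D := (J (nuk a)).
Hypotheses (dm : 0 < dh phim) (e0 : 0 < eps).
Hypothesis sol : wave_profile a f c phim phip eps phi.
Notation l := ((dh phim / eps) `^ a^-1).

Let G0 : 0 < G. Proof. exact: Gamma1a_gt0. Qed.
Let Ge0 : 0 < G / eps. Proof. exact: divr_gt0. Qed.
Let w x := phim - phi x.
Let W := phim - phip.
Let W0 : 0 < W. Proof. by rewrite subr_gt0. Qed.

Let dw (x : R) : der w x (- derive1 phi x).
Proof.
case: sol => dphi _ _ _ _.
by have := derB (der_cst phim x) (derivable_der (dphi x)); rewrite sub0r.
Qed.

Let cdw : continuous (fun x => - derive1 phi x).
Proof. by case: sol => _ cd _ _ _ x; apply: cvgN; exact: cd. Qed.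

Let cw : continuous w.
Proof. by move=> x; exact: der_cont (dw x). Qed.

Let lw x : lcont w x.
Proof. by move=> y _; exact: cw. Qed.

Let wNy : w x @[x --> -oo] --> 0.
Proof.
case: sol => _ _ _ hN _; rewrite -[X in _ --> X](subrr phim).
by apply: cvgB hN; exact: cvg_cst.
Qed.

Let wy : w x @[x --> +oo] --> W.
Proof. by case: sol => _ _ _ _ hy; apply: cvgB hy; exact: cvg_cst. Qed.

Let hS : exists S, forall x, `|w x| <= S.
Proof. exact: bounded_limits cw wNy wy. Qed.

Let tw x : tame w x.
Proof. by have [S h] := hS; exact: C1_tame dw cdw h x. Qed.

Lemma profile_D (x : R) : D w x = - (G / eps) * h (phi x).
Proof.
have [dphi cdphi /(_ x)[def ->] _ _] := sol.
have cphi : continuous phi by move=> y; exact: der_cont (derivable_der (dphi y)).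
have tphi : tame phi x.
  have [L hL] := tw x; exists L => t t0; have := hL t t0.
  by rewrite /w -normrN (_ : - (phim - phi x - (phim - phi (x - t))) =
    phi x - phi (x - t)); last ring.
have lphi : lcont phi x by move=> y _; exact: cphi.
rewrite (frac_deriv_J a0 a1 dphi cdphi tphi def).
rewrite (J_subr a0 a1 phim (adm_nuk a0) lphi tphi).
by field; rewrite !gt_eqF.
Qed.

Lemma rate_gt0 : 0 < l.
Proof. by rewrite powR_gt0// divr_gt0. Qed.

Lemma profile_left : exists m C x1, [/\ 0 < m, 0 < C &
  forall x, x <= x1 -> `|w x - m * expl l x| <= C * expl l x ^+ 2].
Proof.
have [b kb] := laplace_kernel_exists a0 a1 rate_gt0.
have lb : l * hintegral b = G / eps * dh phim.
  case: (kb) => _ _ _ _ [_ ->]; rewrite (hintegral_ek a0 a1 rate_gt0) -powRrM.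
  by rewrite mulVf ?gt_eqF// powRr1 ?divr_ge0 ?(ltW dm) ?(ltW e0)//; ring.
have [S S0 hq] := wave_h_quadratic c phim fs.
have [B hB] := hS.
pose p u := G / eps * (h (phim - u) + dh phim * u).
have eqw x : l * hintegral b * w x - D w x = p (w x).
  by rewrite profile_D lb /p /w subKr; ring.
have p0 u : 0 <= p u.
  apply: mulr_ge0; first exact: ltW.
  have := wave_h_tangent c phim fs fc phim (phim - u); rewrite wave_h_phim add0r => H.
  have : dh phim * (phim - u - phim) = - (dh phim * u) by ring.
  lra.
have C00 : 0 < G / eps * S by rewrite mulr_gt0.
have p2 u : `|u| <= 1 -> p u <= G / eps * S * u ^+ 2.
  by move=> u1; rewrite /p -[leRHS]mulrA ler_pM2l// hq.
have pc : {for W, continuous p}.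
  apply: contZ; apply: contD; last by apply: contZ; exact: cont_id.
  by apply: cont_shift; exact: (continuous_wave_h fs).
have pW : 0 < p W.
  by rewrite /p /W subKr (wave_h_phip pp cE) add0r; apply: mulr_gt0 => //; exact: mulr_gt0.
exact: (@left_asymptotics _ _ _ _ kb w _ p _ _ _ dw cdw eqw p0 C00 p2 pc pW wNy wy hB).
Qed.

Lemma profile_exp : exists C, \forall x \near -oo, `|phi x - phim| <= C * expR (l * x).
Proof.
have [m [C [x1 [m0 C0 H]]]] := profile_left.
exists (m + C); apply: (@le_nearNy _ _ (Num.min x1 0)) => x.
rewrite le_min => /andP[xx x0].
rewrite distrC -/(w x) -/(expl l x).
have e1 : expl l x <= 1 by rewrite /expl expR_le1 pmulr_rle0// rate_gt0.
have e20 : 0 < expl l x by exact: expl_gt0.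
have h1 : expl l x ^+ 2 <= expl l x by rewrite expr2 ger_pMl.
have h2 : C * expl l x ^+ 2 <= C * expl l x by rewrite ler_pM2l.
have h3 : 0 < m * expl l x by rewrite mulr_gt0.
have := H x xx; rewrite ler_norml => /andP[h4 h5].
by rewrite ler_norml mulrDl; apply/andP; split; lra.
Qed.

Lemma profile_mono (t x : R) : 0 < t -> phi (x + t) < phi x.
Proof.
move=> t0; have [m [C [x1 [m0 C0 H]]]] := profile_left.
pose E := expl l t; have E1 : 1 < E by rewrite /E /expl expR_gt1 mulr_gt0// rate_gt0.
(* By the expansion the increment is at least [m * (E - 1) * e^(l y) - C * (E ^+ 2 + 1) * e^(2 l
   y)], which is positive as soon as [e^(l y) < eta]. *)
pose eta := m * (E - 1) / (C * (E ^+ 2 + 1)).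
have E2 : 0 < E ^+ 2 + 1 by rewrite ltr_wpDl// sqr_ge0.
have eta0 : 0 < eta.
  by apply: divr_gt0; apply: mulr_gt0 => //; rewrite subr_gt0.
have [x2 hx2] := nearNy_le (cvgr_lt _ (expRM_cvgNy rate_gt0) _ eta0).
pose d y := w (y + t) - 1 * w y.
have cwt : continuous (fun y => w (y + t)).
  move=> y; apply: (cont_comp w (fun y => y + t)); last exact: cw.
  by apply: contD; [exact: cont_id|exact: cont_cst].
have lwt y : lcont (fun y => w (y + t)) y by move=> z _; exact: cwt.
have twt y : tame (fun y => w (y + t)) y by apply: tame_shift; exact: tw.
have cd : continuous d.
  by move=> y; have := contB (@cwt y) (contZ 1 (@cw y)); exact.
have td y : tame d y by rewrite /d; apply: tame_lin; [exact: twt|exact: tw].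
have dpos y : y <= Num.min (x1 - t) x2 -> 0 < d y.
  rewrite le_min => /andP[y1 y2].
  have yt : y + t <= x1 by rewrite -lerBrDr.
  have yx : y <= x1 by rewrite (le_trans _ yt)// lerDl ltW.
  have := H _ yt; rewrite ler_norml => /andP[h1 _].
  have := H _ yx; rewrite ler_norml => /andP[_ h2].
  have e : expl l (y + t) = expl l y * E by rewrite /E /expl mulrDr expRD.
  have ey : 0 < expl l y by exact: expl_gt0.
  have h3 : expl l y * (C * (E ^+ 2 + 1)) < m * (E - 1).
    by rewrite -ltr_pdivlMr ?mulr_gt0//; exact: hx2.
  have h4 : expl l y * (expl l y * (C * (E ^+ 2 + 1))) < expl l y * (m * (E - 1)).
    by rewrite ltr_pM2l.
  rewrite e in h1.
  rewrite /d mul1r; have h5 : expl l y * (expl l y * (C * (E ^+ 2 + 1))) =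
    C * (expl l y * E) ^+ 2 + C * expl l y ^+ 2 by ring.
  have h6 : expl l y * (m * (E - 1)) = m * (expl l y * E) - m * expl l y by ring.
  lra.
(* At a zero of [d] the profile takes the same value at [y] and [y + t], and [D w] depends on that
   value only. *)
have hD y : d y = 0 -> D d y = 0.
  move=> /eqP; rewrite /d mul1r subr_eq0 => /eqP dy.
  rewrite (J_linr a0 a1 1 (adm_nuk a0) (lwt y) (@lw y) (twt y) (@tw y)) J_shift.
  rewrite !profile_D mul1r (_ : phi (y + t) = phi y) ?subrr//.
  by move: dy; rewrite /w => /(congr1 (fun z => phim - z)); rewrite !subKr.
by have := comparison a0 a1 cd td dpos hD x; rewrite /d mul1r /w; lra.
Qed.

Lemma profile_nincr (x y : R) : x <= y -> phi y <= phi x.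
Proof.
rewrite le_eqVlt => /predU1P[->//|xy].
have yx : 0 < y - x by rewrite subr_gt0.
by have := profile_mono x yx; rewrite addrC subrK => /ltW.
Qed.

Lemma profile_bounds (x : R) : phip <= phi x <= phim.
Proof.
have [_ _ _ hN hy] := sol; apply/andP; split.
  apply: (cvgr_to_le hy); near=> y; apply: profile_nincr.
  by near: y; apply: nbhs_pinfty_ge; rewrite num_real.
apply: (cvgr_to_ge hN); near=> y; apply: profile_nincr.
by near: y; apply: nbhs_ninfty_le; rewrite num_real.
Unshelve. all: by end_near. Qed.

Let wW x : 0 <= w x <= W.
Proof. by have /andP[h1 h2] := profile_bounds x; rewrite /w /W; apply/andP; split; lra. Qed.

(** Monotonicity keeps [phi] between [u1] and [u2] on the whole segment, and convexity bounds [h]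
    there by its values at the two ends. This is the lower bound on [D w] that [ramp] requires. *)
Lemma profile_transit (u1 u2 x y : R) : x < y -> phi x <= u2 -> u1 <= phi y ->
  - Num.max (h u1) (h u2) * (G / eps) <= cD a * (2 * W) * pk a (y - x).
Proof.
move=> xy xu uy; apply: (ramp a0 a1 cw tw W0 wW xy) => z xz zy.
rewrite profile_D [leRHS](_ : _ = - h (phi z) * (G / eps)); last by ring.
rewrite ler_pM2r// lerN2.
apply: wave_h_le_max => //; first by apply: (le_trans uy); exact: profile_nincr.
by apply: le_trans xu; exact: profile_nincr.
Qed.

(** The factor [eps] comes from the inverse of the rate [G / eps * mu]. The threshold [X] depends on
    the profile, but for [x >= X * 2] it costs only the factor [2] of [pk_half], so that one
    constant serves all [eps]. *)
Lemma profile_tail (d mu : R) : 0 < d -> 0 < mu ->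
  (forall v, phip <= v -> v <= phip + d -> h v <= - mu * (v - phip)) ->
  \forall x \near +oo, `|phi x - phip| <= 8 * cD a * W / (G * mu) * (eps / x `^ a).
Proof.
move=> d0 mu0 hd; have [_ _ _ _ hy] := sol.
have pd : phip < phip + d by rewrite ltrDl.
have [X hX] := neary_ge (cvgr_lt _ hy _ pd).
have rho0 : 0 < G / eps * mu by rewrite mulr_gt0.
have Wphi x : W - w x = phi x - phip by rewrite /W /w; ring.
have [|r hr] := right_tail (X := X) a0 a1 cw tw W0 rho0 wW wy.
  move=> x Xx; rewrite profile_D mulNr -mulrN -mulrA ler_pM2l// Wphi lerNr -mulNr.
  apply: hd; first by have /andP[] := profile_bounds x.
  exact: ltW (hX x Xx).
near=> x.
have xr : r <= x by near: x; apply: nbhs_pinfty_ge; rewrite num_real.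
have xX : X * 2 <= x by near: x; apply: nbhs_pinfty_ge; rewrite num_real.
have x0 : 0 < x by near: x; apply: nbhs_pinfty_gt; rewrite num_real.
have x2 : 0 < x / 2 by rewrite divr_gt0.
rewrite ger0_norm; last by rewrite subr_ge0; have /andP[] := profile_bounds x.
rewrite -Wphi (le_trans (hr x xr))//.
have c0 : 0 < cD a by exact: cD_gt0.
have k0 : 0 < 4 * cD a * W / (G / eps * mu).
  by apply: divr_gt0; apply: mulr_gt0 => //; apply: mulr_gt0 => //; exact: mulr_gt0.
have h1 : pk a (x - X) <= 2 * pk a x.
  have h1 := pk_half a1 x0; apply: le_trans h1; apply: pk_mono => //; lra.
apply: (@le_trans _ _ (4 * cD a * W / (G / eps * mu) * (2 * pk a x))); first by rewrite ler_pM2l.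
rewrite le_eqVlt; apply/orP; left; apply/eqP; rewrite /pk powRN; field.
by rewrite !gt_eqF// powR_gt0.
Unshelve. all: by end_near. Qed.

End profile.

(** * The limit of vanishing [eps] and the uniform tail *)

Unset Implicit Arguments.

Theorem theorem5p2 (R : realType) (alpha : R) (f : R -> R) (phim phip c : R)
    (phi : R -> R -> R)
    (alpha01 : 0 < alpha < 1)
    (f_smooth : smooth f)
    (f_convex : @convex_function R R^o setT f)
    (phi_lt : phip < phim)
    (cE : c = (f phip - f phim) / (phip - phim))
    (c_gt0 : 0 < c)
    (dh_phim : 0 < derive1 (wave_h f c phim) phim)
    (dh_phip : derive1 (wave_h f c phim) phip < 0)
    (phi_sol : forall eps : R, 0 < eps ->
       wave_profile alpha f c phim phip eps (phi eps)) :
  [/\ phase_converges phim phip phi ->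
        exists xi0 : R, forall xi : R,
          (xi < xi0 -> phi eps xi @[eps --> 0^'+] --> phim) /\
          (xi0 < xi -> phi eps xi @[eps --> 0^'+] --> phip),
      forall eps : R, 0 < eps ->
        let lambda := (derive1 (wave_h f c phim) phim / eps) `^ alpha^-1 in
        0 < lambda /\
        exists C : R, \forall xi \near -oo,
          `|phi eps xi - phim| <= C * expR (lambda * xi) &
      exists C : R, forall eps : R, 0 < eps ->
        \forall xi \near +oo,
          `|phi eps xi - phip| <= C * (eps / xi `^ alpha)].
Proof.
have /andP[a0 a1] := alpha01.
set h := wave_h f c phim; pose W := phim - phip.
have W0 : 0 < W by rewrite subr_gt0.
have G0 : 0 < Gamma (1 - alpha) by exact: Gamma1a_gt0.
have cD0 : 0 < cD alpha by exact: cD_gt0.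
split.
- move=> [m [s [/andP[m1 m2] sm /cvg_ex[xi0 sx]]]]; exists xi0.
  have bnd eps x : 0 < eps -> phip <= phi eps x <= phim.
    move=> e0.
    exact: (profile_bounds a0 a1 f_smooth f_convex phi_lt cE dh_phim e0 (phi_sol _ e0)).
  (* Staying between [u1] and [u2] over a length [Y] would force [g * Gamma (1 - alpha) <= eps * K]
     by [profile_transit], where [g > 0] because [h < 0] between the end states; this fails for
     small [eps]. *)
  have small u1 u2 Y : phip < u1 -> u1 < phim -> phip < u2 -> u2 < phim -> 0 < Y ->
      \forall eps \near 0^'+, forall x y, Y <= y - x -> phi eps x <= u2 -> phi eps y < u1.
    move=> u11 u12 u21 u22 Y0.
    pose g := - Num.max (h u1) (h u2).
    have g0 : 0 < g.
      by rewrite oppr_gt0 gt_max !(wave_h_lt0 f_smooth f_convex phi_lt cE dh_phim).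
    pose K := cD alpha * (2 * W) * pk alpha Y.
    have K0 : 0 < K by apply: mulr_gt0; [apply: mulr_gt0 => //; exact: mulr_gt0|exact: pk_gt0].
    have gK0 : 0 < g * Gamma (1 - alpha) / K by apply: divr_gt0 => //; exact: mulr_gt0.
    near=> eps => x y Yxy xu; rewrite ltNge; apply/negP => yu.
    have e0 : 0 < eps by near: eps; exact: nbhs_right_gt.
    have eK : eps < g * Gamma (1 - alpha) / K.
      by near: eps; exact: nbhs_right_lt.
    have xy : x < y by rewrite -subr_gt0 (lt_le_trans Y0).
    have := profile_transit a0 a1 f_smooth f_convex phi_lt cE dh_phim e0 (phi_sol _ e0) xy xu yu.
    rewrite -/g -/W -/h => H.
    have {}H : g * (Gamma (1 - alpha) / eps) <= K.
      apply: (le_trans H); rewrite ler_pM2l; first exact: pk_mono.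
      by apply: mulr_gt0 => //; exact: mulr_gt0.
    move: eK; rewrite ltr_pdivlMr// mulrC -ltr_pdivlMr// => /(le_lt_trans H).
    by rewrite mulrA ltxx.
  move=> xi; split=> xx.
  + pose Y := (xi0 - xi) / 2; have Y0 : 0 < Y by rewrite divr_gt0// subr_gt0.
    have Yl : xi + Y < xi0 by rewrite /Y; lra.
    apply/cvgrPdist_le => d d0.
    (* Were [phi eps xi <= u2], the profile would be below [m] at [s eps], which lies more than [Y]
       further on. The maximum with [m] keeps [u2] above [phip] when [d] is large. *)
    pose u2 := Num.max (phim - d) m.
    have u21 : phip < u2 by rewrite lt_max m1 orbT.
    have u22 : u2 < phim by rewrite gt_max m2 andbT ltrBlDr ltrDl.
    near=> eps.
    have e0 : 0 < eps by near: eps; exact: nbhs_right_gt.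
    have sY : xi + Y < s eps by near: eps; exact: cvgr_gt _ sx _ Yl.
    have H : forall x y, Y <= y - x -> phi eps x <= u2 -> phi eps y < m.
      by near: eps; apply: small.
    have /andP[_ h1] := bnd eps xi e0.
    have h2 : u2 < phi eps xi.
      rewrite ltNge; apply/negP => /(H xi (s eps)); rewrite sm// ltxx lerBrDl ltW//.
      by move=> /(_ isT).
    have h3 : phim - d <= u2 by rewrite le_max lexx.
    rewrite ger0_norm ?subr_ge0//; lra.
  + pose Y := (xi - xi0) / 2; have Y0 : 0 < Y by rewrite divr_gt0// subr_gt0.
    have Yl : xi0 < xi - Y by rewrite /Y; lra.
    apply/cvgrPdist_le => d d0.
    (* The mirror image: starting from the value [m] at [s eps], the profile is below [u1] at [xi],
       more than [Y] further on. *)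
    pose u1 := Num.min (phip + d) m.
    have u11 : phip < u1 by rewrite lt_min m1 andbT ltrDl.
    have u12 : u1 < phim by rewrite gt_min m2 orbT.
    near=> eps.
    have e0 : 0 < eps by near: eps; exact: nbhs_right_gt.
    have sY : s eps < xi - Y by near: eps; exact: cvgr_lt _ sx _ Yl.
    have H : forall x y, Y <= y - x -> phi eps x <= m -> phi eps y < u1.
      by near: eps; apply: small.
    have /andP[h1 _] := bnd eps xi e0.
    have h2 : phi eps xi < u1 by apply: (H (s eps)); rewrite ?sm//; lra.
    have h3 : u1 <= phip + d by rewrite ge_min lexx.
    rewrite ler0_norm ?subr_le0//; lra.
- move=> eps e0 /=; split; first exact: rate_gt0.
  exact: (profile_exp a0 a1 f_smooth f_convex phi_lt cE dh_phim e0 (phi_sol _ e0)).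
- have mu0 : 0 < - (derive1 h phip / 2) by rewrite oppr_gt0 pmulr_llt0.
  have [d d0 hd] := wave_h_le_right f_smooth f_convex phi_lt cE dh_phip.
  (* The constant left open is that of [profile_tail] with [mu = - (derive1 h phip / 2)]; it is
     fixed before [eps], as [mu] and [d] come from [h] alone. *)
  eexists => eps e0.
  apply: (profile_tail a0 a1 f_smooth f_convex phi_lt cE dh_phim e0 (phi_sol _ e0) d0 mu0).
  by move=> v v1 v2; rewrite opprK; exact: hd.
Unshelve. all: by end_near. Qed.
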